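(* For a $k$-step BDF method with $k\le5$ there exists $\tau_0>0$, depending only on the constants $\mu$ and $\kappa$, such that for $\tau\le\tau_0$ and $t_n=n\tau\le T$ (with $n\ge k$) the error $e_n$ is bounded by $$|e_n|_{M_n}^2+\tau\sum_{j=k}^n|e_j|_{A_j}^2\le C\tau\sum_{j=k}^n\|d_j\|_{*,j}^2+C\max_{0\le i\le k-1}|e_i|_{M_i}^2,$$ where $\|\omega\|_{*,j}^2=\omega^T(A(t_j)+M(t_j))^{-1}\omega$. The constant $C$ is independent of $h$, $\tau$ and $n$, but depends on $\mu$, $\kappa$, $T$ and on the norm of the difference of the velocities.
   Context: Surface. $\Gamma(t)\subset\mathbb R^{m+1}$, $t\in[0,T]$, is a closed (compact, oriented, without boundary) smooth hypersurface evolving smoothly: there is a smooth map $\Phi:\Gamma(0)\times[0,T]\to\mathbb R^{m+1}$ with $\Phi(\cdot,0)=\mathrm{Id}$, $\Phi(\cdot,t):\Gamma(0)\to\Gamma(t)$ a diffeomorphism, $\partial_t\Phi(\cdot,t)=v(\Phi(\cdot,t),t)$ ($v$: material velocity). The ALE map $\mathcal A$ is another such smooth map, with ALE velocity $w$; then $v-w$ is tangential. ALE ESFEM. $\Gamma_h(t)$ is a triangulated surface with nodes $a_j(t)=\mathcal A(a_j(0),t)\in\Gamma(t)$, $j=1,\dots,N$, whose simplices form an admissible triangulation (conforming, with inradii bounded below by $ch$, $c$ independent of $h,t$) with maximal diameter $h$. $\chi_j(\cdot,t)$ is the nodal basis of continuous piecewise linear functions on $\Gamma_h(t)$, $\chi_j(a_i(t),t)=\delta_{ij}$;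 $V_h=\sum_jv(a_j(t),t)\chi_j$, $W_h=\sum_jw(a_j(t),t)\chi_j$; $\nabla_{\Gamma_h}$ is the piecewise tangential gradient. Set $M(t)_{kj}=\int_{\Gamma_h(t)}\chi_j\chi_k$, $A(t)_{kj}=\int_{\Gamma_h(t)}\nabla_{\Gamma_h}\chi_j\cdot\nabla_{\Gamma_h}\chi_k$, $B(t)_{kj}=\int_{\Gamma_h(t)}\chi_j(W_h-V_h)\cdot\nabla_{\Gamma_h}\chi_k$. For a symmetric positive semi-definite matrix $K$, $|z|_K^2=z^TKz$; $M_n=M(t_n)$, $A_n=A(t_n)$. Constants $\mu,\kappa$. These are constants independent of $h$ such that for all $y,z\in\mathbb R^N$, $s,t\in[0,T]$: $z^T(M(s)-M(t))y\le(e^{\mu|s-t|}-1)|z|_{M(t)}|y|_{M(t)}$, $z^T(M^{-1}(s)-M^{-1}(t))y\le(e^{\mu|s-t|}-1)|z|_{M^{-1}(t)}|y|_{M^{-1}(t)}$, $z^T(A(s)-A(t))y\le(e^{\kappa|s-t|}-1)|z|_{A(t)}|y|_{A(t)}$. BDF method for $\frac{d}{dt}(M\alpha)+A\alpha+B\alpha=0$ (step size $\tau>0$, $t_n=n\tau$): given starting values $\alpha_0,\dots,\alpha_{k-1}$, $\frac1\tau\sum_{j=0}^k\delta_jM(t_{n-j})\alpha_{n-j}+A(t_n)\alpha_n+B(t_n)\alpha_n=0$ for $n\ge k$, with coefficients given by $\sum_{j=0}^k\delta_j\zeta^j=\sum_{\ell=1}^k\frac1\ell(1-\zeta)^\ell$.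 Perturbed problem and errors. Let $\tilde\alpha$ solve $\frac{d}{dt}(M\tilde\alpha)+A\tilde\alpha+B\tilde\alpha=Mr$, $\tilde\alpha(0)=\tilde\alpha_0$, for a given $r(t)\in\mathbb R^N$. The defects $d_n$ are defined by $\frac1\tau\sum_{j=0}^k\delta_jM(t_{n-j})\tilde\alpha(t_{n-j})+A(t_n)\tilde\alpha(t_n)+B(t_n)\tilde\alpha(t_n)=-d_n$, $n\ge k$, and the error is $e_n=\alpha_n-\tilde\alpha(t_n)$. ''Norm of the difference of the velocities'' refers to the norm of $w-v$ (equivalently the maximum norm of $W_h-V_h$).
   Formalization: The step bound τ_0 is allowed to depend also on (an upper bound for) the norm of the difference of the velocities, not only on μ and κ; with dependence on μ and κ alone the claim fails (stationary circle, inscribed square, large tangential velocity). *)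

(* Defs.v *)
From HB Require Import structures.
From mathcomp Require Import all_boot all_order all_algebra.
From mathcomp Require Import all_classical all_reals all_analysis.

Set Implicit Arguments.
Unset Strict Implicit.
Unset Printing Implicit Defensive.

Import Order.TTheory GRing.Theory Num.Theory.
Import numFieldNormedType.Exports.

Local Open Scope classical_set_scope.
Local Open Scope ring_scope.

(** * Euclidean structure (the library norm on ['rV] is the sup norm) *)

Definition dotv (R : realType) d (u v : 'rV[R]_d) : R := (u *m v^T) 0 0.

Definition normv (R : realType) d (u : 'rV[R]_d) : R := Num.sqrt (dotv u u).

(** * Smooth hypersurfaces and their evolution *)

(* In finite dimension, [Ck_on k U f] is the usual C^k regularity of [f] on the
   open set [U]: all iterated directional derivatives of order at most [k] exist
   and are continuous. *)
Fixpoint Ck_on (R : realType) (V W : normedModType R) (k : nat) (U : set V)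
    (f : V -> W) : Prop :=
  match k with
  | 0%N => forall x, U x -> {for x, continuous f}
  | k'.+1 => (forall x, U x -> differentiable f x) /\
             (forall h : V, Ck_on k' U (fun x => 'd f x h))
  end.

(* Smoothness on an arbitrary subset: local existence of smooth extensions. *)
Definition smooth_on (R : realType) (V W : normedModType R) (S : set V)
    (f : V -> W) : Prop :=
  forall x, S x -> exists U : set V, [/\ open U, U x &
    exists g : V -> W, (forall k, Ck_on k U g) /\
                       (forall y, S y -> U y -> g y = f y)].

Definition hypersurface (R : realType) (m : nat) (S : set 'rV[R]_m.+1) : Prop :=
  forall x, S x -> exists U : set 'rV[R]_m.+1, [/\ open U, U x &
    exists g : 'rV[R]_m.+1 -> R, [/\ forall k, Ck_on k U g,
      forall y, U y -> (S y <-> g y = 0) &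
      forall y, U y -> S y -> exists h, 'd g y h != 0]].

Definition tangent (R : realType) (m : nat) (S : set 'rV[R]_m.+1)
    (x u : 'rV[R]_m.+1) : Prop :=
  exists gam : R -> 'rV[R]_m.+1,
    [/\ gam 0 = x, is_derive (0 : R) (1 : R) gam u & \forall s \near (0 : R), S (gam s)].

Definition oriented (R : realType) (m : nat) (S : set 'rV[R]_m.+1) : Prop :=
  exists nu : 'rV[R]_m.+1 -> 'rV[R]_m.+1, smooth_on S nu /\
    forall x, S x -> normv (nu x) = 1 /\ forall u, tangent S x u -> dotv (nu x) u = 0.

Definition closed_hypersurface (R : realType) (m : nat) (S : set 'rV[R]_m.+1) : Prop :=
  [/\ compact S, hypersurface S & oriented S].

Definition diffeo (R : realType) (m : nat) (S S' : set 'rV[R]_m.+1)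
    (f : 'rV[R]_m.+1 -> 'rV[R]_m.+1) : Prop :=
  [/\ smooth_on S f, forall x, S x -> S' (f x) &
    exists g, [/\ smooth_on S' g, forall y, S' y -> S (g y),
      forall x, S x -> g (f x) = x & forall y, S' y -> f (g y) = y]].

(* [l] is the derivative of [f] at [t] relative to [0, T]; it is one-sided at
   the endpoints. *)
Definition deriv_in (R : realType) (V : normedModType R) (T : R) (f : R -> V)
    (t : R) (l : V) : Prop :=
  (fun s => (s - t)^-1 *: (f s - f t))
    @ within [set s | 0 <= s <= T /\ s != t] (nbhs t) --> l.

(* [F t x] is the image at time [t] of the point [x] of [Gam 0]; [u t] is the
   velocity field of [F] on [Gam t]. *)
Definition flow_map (R : realType) (m : nat) (T : R) (Gam : R -> set 'rV[R]_m.+1)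
    (F u : R -> 'rV[R]_m.+1 -> 'rV[R]_m.+1) : Prop :=
  [/\ smooth_on [set z : 'rV[R]_m.+1 * R | Gam 0 z.1 /\ 0 <= z.2 <= T]
        (fun z : 'rV[R]_m.+1 * R => F z.2 z.1),
      forall x, Gam 0 x -> F 0 x = x,
      forall t, 0 <= t <= T -> diffeo (Gam 0) (Gam t) (F t) &
      forall t x, 0 <= t <= T -> Gam 0 x ->
        deriv_in T (fun s => F s x) t (u t (F t x))].

(** * Triangulated surfaces

   A mesh has nodes [a : 'I_N -> 'rV_m.+1] and a connectivity table
   [elt : 'I_L -> 'I_m.+1 -> 'I_N] giving the vertices of each m-simplex. *)

Definition aff (R : realType) (m N : nat) (a : 'I_N -> 'rV[R]_m.+1)
    (P : {pred 'I_N}) : set 'rV[R]_m.+1 :=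
  [set x | exists lam : 'I_N -> R, [/\ forall i, i \notin P -> lam i = 0,
     \sum_i lam i = 1 & x = \sum_i lam i *: a i]].

Definition hull (R : realType) (m N : nat) (a : 'I_N -> 'rV[R]_m.+1)
    (P : {pred 'I_N}) : set 'rV[R]_m.+1 :=
  [set x | exists lam : 'I_N -> R, [/\ forall i, 0 <= lam i,
     forall i, i \notin P -> lam i = 0,
     \sum_i lam i = 1 & x = \sum_i lam i *: a i]].

Definition simplex (R : realType) (m N : nat) (a : 'I_N -> 'rV[R]_m.+1)
    (K : 'I_m.+1 -> 'I_N) : set 'rV[R]_m.+1 := hull a (mem (codom K)).

Definition discrete_surface (R : realType) (m N L : nat) (a : 'I_N -> 'rV[R]_m.+1)
    (elt : 'I_L -> 'I_m.+1 -> 'I_N) : set 'rV[R]_m.+1 :=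
  [set x | exists p, simplex a (elt p) x].

Definition edges (R : realType) (m N : nat) (a : 'I_N -> 'rV[R]_m.+1)
    (K : 'I_m.+1 -> 'I_N) : 'M[R]_(m, m.+1) :=
  \matrix_(i < m) (a (K (lift ord0 i)) - a (K ord0)).

Definition gram (R : realType) (m N : nat) (a : 'I_N -> 'rV[R]_m.+1)
    (K : 'I_m.+1 -> 'I_N) : 'M[R]_m := edges a K *m (edges a K)^T.

Definition diam (R : realType) (m : nat) (S : set 'rV[R]_m.+1) : R :=
  sup [set normv (x - y) | x in S & y in S].

(* Radius of the largest m-dimensional ball, taken in the plane spanned by the
   simplex, that the simplex contains. *)
Definition inradius (R : realType) (m N : nat) (a : 'I_N -> 'rV[R]_m.+1)
    (K : 'I_m.+1 -> 'I_N) : R :=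
  sup [set r | 0 <= r /\ exists2 x, aff a (mem (codom K)) x &
    forall y, aff a (mem (codom K)) y -> normv (y - x) <= r -> simplex a K y].

(* Topological m-manifold without boundary, as a subspace of R^(m+1). *)
Definition locally_euclidean (R : realType) (m : nat) (S : set 'rV[R]_m.+1) : Prop :=
  forall x, S x -> exists (U : set 'rV[R]_m.+1) (V : set 'rV[R]_m), [/\ open U, U x, open V &
    exists (f : 'rV[R]_m.+1 -> 'rV[R]_m) (g : 'rV[R]_m -> 'rV[R]_m.+1),
      [/\ {within S `&` U, continuous f}, {within V, continuous g},
          forall y, S y -> U y -> V (f y) /\ g (f y) = y &
          forall z, V z -> [/\ S (g z), U (g z) & f (g z) = z]]].

Definition triangulation (R : realType) (m N L : nat) (a : 'I_N -> 'rV[R]_m.+1)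
    (elt : 'I_L -> 'I_m.+1 -> 'I_N) : Prop :=
  [/\ forall j, exists p, j \in codom (elt p),
      forall p, injective (elt p) /\ row_free (edges a (elt p)),
      forall p q, p != q -> ~ (codom (elt p) =i codom (elt q)),
      forall p q, simplex a (elt p) `&` simplex a (elt q) =
                  hull a [predI codom (elt p) & codom (elt q)] &
      locally_euclidean (discrete_surface a elt)].

Definition mesh_size (R : realType) (m N L : nat) (T : R)
    (a : R -> 'I_N -> 'rV[R]_m.+1) (elt : 'I_L -> 'I_m.+1 -> 'I_N) : R :=
  sup [set d | exists t p, 0 <= t <= T /\ d = diam (simplex (a t) (elt p))].

Definition admissible (R : realType) (m N L : nat) (T h c : R)
    (a : R -> 'I_N -> 'rV[R]_m.+1) (elt : 'I_L -> 'I_m.+1 -> 'I_N) : Prop :=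
  [/\ forall t, 0 <= t <= T -> triangulation (a t) elt,
      h = mesh_size T a elt &
      forall t p, 0 <= t <= T -> c * h <= inradius (a t) (elt p)].

(** * Integration over a triangulated surface *)

Definition cons_pair (R : realType) (n : nat)
    (z : n.-tuple (measurableTypeR R) * measurableTypeR R) :
    n.+1.-tuple (measurableTypeR R) := [the n.+1.-tuple _ of z.2 :: z.1].

Lemma measurable_cons_pair (R : realType) (n : nat) :
  measurable_fun setT (@cons_pair R n).
Proof.
by apply: measurable_cons; [exact: measurable_snd | exact: measurable_fst].
Qed.

Definition lebesgue_ext (R : realType) (n : nat)
    (mu : {measure set (n.-tuple (measurableTypeR R)) -> \bar R}) :
    set (n.+1.-tuple (measurableTypeR R)) -> \bar R :=
  pushforward (mu \x (@lebesgue_measure R))%E (@cons_pair R n).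

HB.instance Definition _ (R : realType) (n : nat)
    (mu : {measure set (n.-tuple (measurableTypeR R)) -> \bar R}) :=
  Measure.copy (lebesgue_ext mu)
    (measure_function_pushforward__canonical__measure_function_Measure
       (mu \x (@lebesgue_measure R))%E (@measurable_cons_pair R n)).

(* n-dimensional Lebesgue measure: n-fold product of [lebesgue_measure]. *)
Fixpoint lebesgue_tuple (R : realType) (n : nat) :
    {measure set (n.-tuple (measurableTypeR R)) -> \bar R} :=
  match n with
  | 0%N => dirac [tuple]
  | n'.+1 => lebesgue_ext (@lebesgue_tuple R n')
  end.
Arguments lebesgue_tuple : clear implicits.

Definition unit_simplex (R : realType) (m : nat) :
    set (m.-tuple (measurableTypeR R)) :=
  [set xi | (forall i, 0 <= tnth xi i) /\ \sum_(i < m) tnth xi i <= 1].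
Arguments unit_simplex : clear implicits.

Definition elt_map (R : realType) (m N : nat) (a : 'I_N -> 'rV[R]_m.+1)
    (K : 'I_m.+1 -> 'I_N) (xi : m.-tuple (measurableTypeR R)) : 'rV[R]_m.+1 :=
  a (K ord0) + (\row_(i < m) (tnth xi i : R)) *m edges a K.

(* The integrand may depend on the simplex, as piecewise gradients do; the faces
   shared by two simplices are null sets. *)
Definition surface_integral (R : realType) (m N L : nat) (a : 'I_N -> 'rV[R]_m.+1)
    (elt : 'I_L -> 'I_m.+1 -> 'I_N) (f : 'I_L -> 'rV[R]_m.+1 -> R) : R :=
  \sum_(p < L) Num.sqrt (\det (gram a (elt p))) *
    Rintegral (lebesgue_tuple R m) (unit_simplex R m)
      (fun xi => f p (elt_map a (elt p) xi)).

(** * Piecewise linear finite elements *)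

Definition affine_on_simplex (R : realType) (m N : nat) (a : 'I_N -> 'rV[R]_m.+1)
    (K : 'I_m.+1 -> 'I_N) (f : 'rV[R]_m.+1 -> R) : Prop :=
  forall x y (s : R), simplex a K x -> simplex a K y -> 0 <= s <= 1 ->
    f (s *: x + (1 - s) *: y) = s * f x + (1 - s) * f y.

Definition nodal_basis (R : realType) (m N L : nat) (a : 'I_N -> 'rV[R]_m.+1)
    (elt : 'I_L -> 'I_m.+1 -> 'I_N) (chi : 'I_N -> 'rV[R]_m.+1 -> R) : Prop :=
  forall j, [/\ {within discrete_surface a elt, continuous (chi j)},
    forall p, affine_on_simplex a (elt p) (chi j) &
    forall i, chi j (a i) = (i == j)%:R].

(* Nodal interpolation, giving [V_h] and [W_h] from [v] and [w]. *)
Definition interp (R : realType) (m N : nat) (a : 'I_N -> 'rV[R]_m.+1)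
    (chi : 'I_N -> 'rV[R]_m.+1 -> R) (u : 'rV[R]_m.+1 -> 'rV[R]_m.+1)
    (x : 'rV[R]_m.+1) : 'rV[R]_m.+1 := \sum_j chi j x *: u (a j).

(* Tangential gradient, on the simplex [K], of a function affine on [K]: the
   coordinate expression g^{ij} (d_j f) (d_i X) in the affine parametrization
   [elt_map], i.e. the vector spanned by the edges whose inner products with
   the edges are the increments of [f]. *)
Definition simplex_grad (R : realType) (m N : nat) (a : 'I_N -> 'rV[R]_m.+1)
    (K : 'I_m.+1 -> 'I_N) (f : 'rV[R]_m.+1 -> R) : 'rV[R]_m.+1 :=
  (\row_(i < m) (f (a (K (lift ord0 i))) - f (a (K ord0))))
    *m invmx (gram a K) *m edges a K.

Definition mass_mx (R : realType) (m N L : nat) (a : 'I_N -> 'rV[R]_m.+1)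
    (elt : 'I_L -> 'I_m.+1 -> 'I_N) (chi : 'I_N -> 'rV[R]_m.+1 -> R) : 'M[R]_N :=
  \matrix_(k, j) surface_integral a elt (fun _ x => chi j x * chi k x).

Definition stiffness_mx (R : realType) (m N L : nat) (a : 'I_N -> 'rV[R]_m.+1)
    (elt : 'I_L -> 'I_m.+1 -> 'I_N) (chi : 'I_N -> 'rV[R]_m.+1 -> R) : 'M[R]_N :=
  \matrix_(k, j) surface_integral a elt (fun p _ =>
    dotv (simplex_grad a (elt p) (chi j)) (simplex_grad a (elt p) (chi k))).

Definition advection_mx (R : realType) (m N L : nat) (a : 'I_N -> 'rV[R]_m.+1)
    (elt : 'I_L -> 'I_m.+1 -> 'I_N) (chi : 'I_N -> 'rV[R]_m.+1 -> R)
    (v w : 'rV[R]_m.+1 -> 'rV[R]_m.+1) : 'M[R]_N :=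
  \matrix_(k, j) surface_integral a elt (fun p x =>
    chi j x * dotv (interp a chi w x - interp a chi v x)
                   (simplex_grad a (elt p) (chi k))).

(** * Matrix norms, conditions on [mu] and [kappa] *)

Definition quad (R : realType) (N : nat) (K : 'M[R]_N) (z y : 'cV[R]_N) : R :=
  (z^T *m K *m y) 0 0.

Definition mxnorm (R : realType) (N : nat) (K : 'M[R]_N) (z : 'cV[R]_N) : R :=
  Num.sqrt (quad K z z).

Definition growth_bound (R : realType) (N : nat) (T : R) (K : R -> 'M[R]_N)
    (rate : R) : Prop :=
  forall (y z : 'cV[R]_N) (s t : R), 0 <= s <= T -> 0 <= t <= T ->
    quad (K s - K t) z y <=
      (expR (rate * `|s - t|) - 1) * mxnorm (K t) z * mxnorm (K t) y.

(* Square of the dual norm [omega^T (A + M)^-1 omega]. *)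
Definition dual_norm2 (R : realType) (N : nat) (M A : 'M[R]_N) (om : 'cV[R]_N) : R :=
  quad (invmx (A + M)) om om.

(** * BDF methods *)

Definition bdf_poly (R : realType) (k : nat) : {poly R} :=
  \sum_(1 <= l < k.+1) (l%:R)^-1 *: (1 - 'X) ^+ l.

Definition bdf_coef (R : realType) (k j : nat) : R := (bdf_poly R k)`_j.

(* Residual at step [n], to be used for [k <= n]: nat subtraction truncates. *)
Definition bdf_residual (R : realType) (k N : nat) (tau : R) (M A B : R -> 'M[R]_N)
    (x : nat -> 'cV[R]_N) (n : nat) : 'cV[R]_N :=
  tau^-1 *: (\sum_(j < k.+1)
      bdf_coef R k j *: (M ((n - j)%:R * tau) *m x (n - j)%N))
  + A (n%:R * tau) *m x n + B (n%:R * tau) *m x n.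

(* Main.v *)
(* Energy estimate for the error equation tested with [e_n - 9/10 e_{n-1}]
   (Nevanlinna-Odeh multiplier).  By Dahlquist's G-stability the discrete time
   derivative bounds the increment of a G-norm built from the mass matrix; the
   same multiplier works for all [k <= 5].  The growth bounds replace
   [M(t_{n-j})] by [M(t_n)] at a cost O(tau), the drift matrix satisfies
   |z^T B y| <= omega |y|_M |z|_A, and Gronwall's inequality concludes.  The
   multiplier would bring |e_{k-1}|_A into the estimate; this is avoided by
   testing the first equation, [n = k], with [e_k] alone, which bounds
   |e_k|_M^2 + tau |e_k|_A^2 by the M-norms of the starting values. *)

From Stdlib Require Import ZArith.
Require Import Defs.
From HB Require Import structures.
From mathcomp Require Import all_boot all_order all_algebra.
From mathcomp Require Import all_classical all_reals all_analysis.
From mathcomp Require Import measurable_realfun ring lra zify ssrZ.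

Set Implicit Arguments.
Unset Strict Implicit.
Unset Printing Implicit Defensive.

Import Order.TTheory GRing.Theory Num.Theory.
Import numFieldNormedType.Exports.

Local Open Scope classical_set_scope.
Local Open Scope ring_scope.

(** * Quadratic forms *)

Section QuadraticForms.
Variables (R : realType) (N : nat).
Implicit Types (K : 'M[R]_N) (x y z : 'cV[R]_N).

Lemma quadDl K x y z : quad K (x + y) z = quad K x z + quad K y z.
Proof. by rewrite /quad linearD /= !mulmxDl mxE. Qed.

Lemma quadDr K x y z : quad K x (y + z) = quad K x y + quad K x z.
Proof. by rewrite /quad mulmxDr mxE. Qed.

Lemma quadZl K (c : R) x y : quad K (c *: x) y = c * quad K x y.
Proof. by rewrite /quad linearZ /= -!scalemxAl mxE. Qed.

Lemma quadZr K (c : R) x y : quad K x (c *: y) = c * quad K x y.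
Proof. by rewrite /quad -scalemxAr mxE. Qed.

Lemma quad0l K y : quad K 0 y = 0.
Proof. by rewrite -(scale0r 0) quadZl mul0r. Qed.

Lemma quad0r K y : quad K y 0 = 0.
Proof. by rewrite -(scale0r 0) quadZr mul0r. Qed.

Lemma quadNl K x y : quad K (- x) y = - quad K x y.
Proof. by rewrite -scaleN1r quadZl mulN1r. Qed.

Lemma quadNr K x y : quad K x (- y) = - quad K x y.
Proof. by rewrite -scaleN1r quadZr mulN1r. Qed.

Lemma quad_suml K (I : Type) (r : seq I) (F : I -> 'cV[R]_N) y :
  quad K (\sum_(i <- r) F i) y = \sum_(i <- r) quad K (F i) y.
Proof.
elim/big_rec2: _ => [|i a b _ <-]; last by rewrite quadDl.
exact: quad0l.
Qed.

Lemma quad_sumr K (I : Type) (r : seq I) (F : I -> 'cV[R]_N) y :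
  quad K y (\sum_(i <- r) F i) = \sum_(i <- r) quad K y (F i).
Proof.
elim/big_rec2: _ => [|i a b _ <-]; last by rewrite quadDr.
exact: quad0r.
Qed.

Lemma quad_mxD K K' x y : quad (K + K') x y = quad K x y + quad K' x y.
Proof. by rewrite /quad mulmxDr mulmxDl mxE. Qed.

Lemma quad_mxN K x y : quad (- K) x y = - quad K x y.
Proof. by rewrite /quad mulmxN mulNmx mxE. Qed.

Lemma quad_mulmx K K' x y : quad K x (K' *m y) = quad (K *m K') x y.
Proof. by rewrite /quad !mulmxA. Qed.

Lemma quad1_mulmx K x y : quad 1%:M x (K *m y) = quad K x y.
Proof. by rewrite quad_mulmx mul1mx. Qed.

Lemma quad_sym K x y : K^T = K -> quad K x y = quad K y x.
Proof.
move=> sK; rewrite /quad -[in LHS]sK -[x^T *m _ *m _]trmxK mxE.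
by rewrite !trmx_mul !trmxK mulmxA.
Qed.

Definition psd K := K^T = K /\ forall x, 0 <= quad K x x.

Lemma quad_young K x y (s : R) : psd K -> 0 < s ->
  quad K x y <= s / 2 * quad K x x + (2 * s)^-1 * quad K y y.
Proof.
move=> [sK pK] s0; have := pK (s *: x - y).
rewrite quadDl !quadDr !quadNl !quadNr !quadZl !quadZr (quad_sym y x sK) => h.
have -> : s / 2 * quad K x x + (2 * s)^-1 * quad K y y = quad K x y +
  (2 * s)^-1 * (s * (s * quad K x x) - s * quad K x y -
                (s * quad K x y - quad K y y)).
  by field; rewrite gt_eqF.
rewrite lerDl mulr_ge0// ?invr_ge0; lra.
Qed.

Lemma quad_sqrD K x y : psd K ->
  quad K (x + y) (x + y) <= 2 * quad K x x + 2 * quad K y y.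
Proof.
move=> pK; have := quad_young x y pK ltr01; have [sK _] := pK.
rewrite !quadDl !quadDr (quad_sym y x sK); lra.
Qed.

Lemma mxnorm_sqr K x : psd K -> mxnorm K x ^+ 2 = quad K x x.
Proof. by move=> [_ pK]; rewrite sqr_sqrtr. Qed.

End QuadraticForms.

Section Growth.
Variables (R : realType) (N : nat).
Implicit Types (K : R -> 'M[R]_N) (x y z : 'cV[R]_N).

Lemma growth_quad_sub (T : R) K (rate : R) x y s t :
  growth_bound T K rate -> psd (K t) -> 0 <= s <= T -> 0 <= t <= T ->
  `|quad (K s - K t) x y| <=
    (expR (`|rate| * `|s - t|) - 1) * ((quad (K t) x x + quad (K t) y y) / 2).
Proof.
move=> gK pK hs ht.
have bd z : quad (K s - K t) z y <= (expR (`|rate| * `|s - t|) - 1) *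
    ((quad (K t) z z + quad (K t) y y) / 2).
  apply: le_trans (gK y z s t hs ht) _; rewrite -mulrA.
  have hz : mxnorm (K t) z * mxnorm (K t) y <=
      (quad (K t) z z + quad (K t) y y) / 2.
    rewrite -!mxnorm_sqr//.
    have := sqr_ge0 (mxnorm (K t) z - mxnorm (K t) y); nra.
  have h0 : 0 <= mxnorm (K t) z * mxnorm (K t) y by rewrite mulr_ge0// sqrtr_ge0.
  have he : expR (rate * `|s - t|) - 1 <= expR (`|rate| * `|s - t|) - 1.
    by rewrite lerB// ler_expR ler_wpM2r// ler_norm.
  have hp : 0 <= expR (`|rate| * `|s - t|) - 1.
    by rewrite subr_ge0 -expR0 ler_expR mulr_ge0.
  apply: le_trans (ler_wpM2r h0 he) _; exact: ler_wpM2l.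
rewrite ler_norml bd andbT.
by have := bd (- x); rewrite quadNl quadNl quadNr opprK lerNl.
Qed.

Lemma growth_quad (T : R) K (rate : R) x s t :
  growth_bound T K rate -> psd (K t) -> 0 <= s <= T -> 0 <= t <= T ->
  quad (K s) x x <= expR (`|rate| * `|s - t|) * quad (K t) x x.
Proof.
move=> gK pK hs ht.
have := le_trans (ler_norm _) (growth_quad_sub x x gK pK hs ht).
rewrite quad_mxD quad_mxN; lra.
Qed.

End Growth.

(** * G-stability of the BDF methods *)

Section BdfData.
Local Open Scope Z_scope.

(* [60 * delta_j], a common denominator [s = scale], weighted squares whose sum is
   [s] times the squared G-norm, and weighted squares whose sum is [s] times the
   defect of the G-stability inequality with multiplier [1 - 9/10 zeta].  They
   come from a rational approximation of the spectral factor of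
   Re (delta(zeta) (1 - 9/10 / zeta)) / |1 - zeta|^2 on the unit circle. *)
Record bdf_data := BdfData {
  delta60 : seq Z; scale : Z; gsq : seq (Z * seq Z); dsq : seq (Z * seq Z) }.

Definition bdf_table (k : nat) : bdf_data :=
  match k with
  | 1%N => BdfData [:: 60; -60]
      20
      [:: (1, [:: 1])]
      [:: (19, [:: 1; -1])]
  | 2%N => BdfData [:: 90; -120; 30]
      960
      [:: (45, [:: 1; 0]);
       (3, [:: -9; 8])]
      [:: (2, [:: 24; -29; 5]);
       (142, [:: 0; 1; -1])]
  | 3%N => BdfData [:: 110; -180; 90; -20]
      2732400
      [:: (122935, [:: 1; 0; 0]);
       (345, [:: -71; 66; 0]);
       (5060, [:: 1; -9; 9])]
      [:: (660, [:: 69; -103; 44; -10]);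
       (528, [:: 0; 25; -8; -17]);
       (191268, [:: 0; 0; 1; -1])]
  | 4%N => BdfData [:: 125; -240; 180; -80; 15]
      75348844831219680
      [:: (3333711702783546, [:: 1; 0; 0; 0]);
       (1983457287, [:: -2444; 2553; 0; 0]);
       (10127532907422, [:: 50; -76; 31; 0]);
       (156976760065041, [:: -16; 25; -16; 6])]
      [:: (1291989794774, [:: 243; -343; 182; -112; 30]);
       (54898861, [:: 0; 23534; -37204; 21605; -7935]);
       (192317490, [:: 0; 0; 2081; -2794; 713]);
       (933940060723341, [:: 0; 0; 0; 1; -1])]
  | 5%N => BdfData [:: 137; -300; 300; -200; 75; -12]
      10578193501624902166926807134287740000
      [:: (431030934017737565778362144766945150, [:: 1; 0; 0; 0; 0]);
       (2218541885433908650, [:: -1049799715; 968517271; 0; 0; 0]);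
       (806719028526241357822900, [:: 2602758; -3974215; 1367521; 0; 0]);
       (32447212135565709055627353850, [:: -9614; 19019; -15245; 5327; 0]);
       (518538897138475596417980741876850, [:: 70; -154; 154; -75; 17])]
      [:: (3361998951698735750993772925975, [:: 1748; -2585; 2251; -2254; 1020; -180]);
       (70667345280057503962034113, [:: 0; 47575; -80665; 65044; -33370; 1416]);
       (6454515599829685281933098, [:: 0; 0; 47845; -119947; 30810; 41292]);
       (200915892029362023654772001700, [:: 0; 0; 0; 431; -650; 219]);
       (20146018173048199215821548776630750, [:: 0; 0; 0; 0; 1; -1])]
  | _ => BdfData [::] 1 [::] [::]
  end.

Definition sos_coef (S : seq (Z * seq Z)) (i j : nat) : Z :=
  foldr (fun p acc => p.1 * (nth 0 p.2 i * nth 0 p.2 j) + acc) 0 S.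

Definition bdf_check (k : nat) : bool :=
  let: BdfData d s G D := bdf_table k in
  let G' := map (fun p => (p.1, 0 :: p.2)) G in
  let mu := [:: 10; -9] in
  [&& 0 <? s, size d == k.+1, all (fun p => 0 <? p.1) (G ++ D),
    all (fun p => size p.2 == k) G, all (fun p => size p.2 == k.+1) D,
    (if G is (_, x :: r) :: _ then (x =? 1) && all (Z.eqb 0) r else false) &
    all (fun i => all (fun j =>
      s * (nth 0 mu i * nth 0 d j + nth 0 mu j * nth 0 d i) +
        1200 * sos_coef G' i j =?
      1200 * (sos_coef G i j + sos_coef D i j)) (iota 0 k.+1)) (iota 0 k.+1)].

Lemma bdf_checked k : (1 <= k <= 5)%N -> bdf_check k.
Proof. by case: k => [|[|[|[|[|[|k]]]]]] // _; vm_compute. Qed.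

End BdfData.

Section GStability.
Variable R : realType.

Definition zr : Z -> R := intr \o int_of_Z.

HB.instance Definition _ := GRing.RMorphism.on zr.

Lemma zrD a b : zr (Z.add a b) = zr a + zr b.
Proof. exact: (rmorphD zr). Qed.

Lemma zrM a b : zr (Z.mul a b) = zr a * zr b.
Proof. exact: (rmorphM zr). Qed.

Lemma zr_gt0 z : Z.ltb 0 z -> 0 < zr z.
Proof. by case: z => //= p _; rewrite /zr /= ltr0z; lia. Qed.

Lemma coef_1subXn l j : ((1 - 'X) ^+ l : {poly R})`_j = (-1) ^+ j *+ 'C(l, j).
Proof.
elim: l j => [|l IH] j.
  by rewrite expr0 coef1 bin0n; case: j => [|j] //=; rewrite mulr0n.
rewrite exprS mulrBl mul1r coefB coefXM !IH; case: j => [|j] /=.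
  by rewrite subr0 !bin0.
by rewrite binS mulrnDr exprS mulN1r !mulNrn.
Qed.

Lemma bdf_coefE k j : (1 <= k <= 5)%N -> (j <= k)%N ->
  60 * bdf_coef R k j = zr (nth Z0 (delta60 (bdf_table k)) j).
Proof.
rewrite /bdf_coef /bdf_poly coef_sum => hk hj.
under eq_bigr do rewrite coefZ coef_1subXn.
rewrite /index_iota /zr /=.
by case: k hk hj => [|[|[|[|[|[|k]]]]]] // _; case: j => [|[|[|[|[|[|j]]]]]] // _;
  rewrite /= !big_cons big_nil !binE /Pos.to_nat /= ?NegzE ?mulrNz -?pmulrn; lra.
Qed.

Definition lcomb N (c : seq Z) (v : nat -> 'cV[R]_N) : 'cV[R]_N :=
  \sum_(i < size c) zr (nth Z0 c i) *: v i.

Definition sos N (S : seq (Z * seq Z)) (K : 'M[R]_N) (v : nat -> 'cV[R]_N) : R :=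
  \sum_(p <- S) zr p.1 * quad K (lcomb p.2 v) (lcomb p.2 v).

Lemma lcomb_widen N c n (v : nat -> 'cV[R]_N) : (size c <= n)%N ->
  lcomb c v = \sum_(i < n) zr (nth Z0 c i) *: v i.
Proof.
move=> cn; rewrite /lcomb (big_ord_widen n (fun i => zr (nth Z0 c i) *: v i) cn).
rewrite big_mkcond; apply: eq_bigr => i _; case: ltnP => // hi.
by rewrite nth_default// rmorph0 scale0r.
Qed.

Lemma lcomb_cons0 N c (v : nat -> 'cV[R]_N) :
  lcomb (Z0 :: c) v = lcomb c (v \o succn).
Proof.
rewrite /lcomb /= big_ord_recl /= rmorph0 scale0r add0r.
by apply: eq_bigr.
Qed.

Lemma quad_sum2 N (K : 'M[R]_N) n (a b : nat -> R) (v : nat -> 'cV[R]_N) :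
  quad K (\sum_(i < n) a i *: v i) (\sum_(i < n) b i *: v i) =
  \sum_(i < n) \sum_(j < n) a i * b j * quad K (v i) (v j).
Proof.
rewrite quad_suml; apply: eq_bigr => i _; rewrite quad_sumr.
by apply: eq_bigr => j _; rewrite quadZl quadZr mulrA.
Qed.

Lemma sosE N (K : 'M[R]_N) n S (v : nat -> 'cV[R]_N) :
  all (fun p => (size p.2 <= n)%N) S ->
  sos S K v =
  \sum_(i < n) \sum_(j < n) zr (sos_coef S i j) * quad K (v i) (v j).
Proof.
rewrite /sos; elim: S => [_|p S IH /= /andP[hp /IH{}IH]].
  by rewrite big_nil big1// => i _; rewrite big1// => j _; rewrite rmorph0 mul0r.
rewrite big_cons IH (lcomb_widen _ hp).
rewrite (quad_sum2 K n (fun i => zr (nth Z0 p.2 i)) (fun i => zr (nth Z0 p.2 i))).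
rewrite big_distrr -big_split; apply: eq_bigr => i _ /=.
rewrite big_distrr -big_split; apply: eq_bigr => j _ /=.
by rewrite zrD !zrM; ring.
Qed.

Lemma quad_lincomb_le N (K : 'M[R]_N) n (a : nat -> R) (v : nat -> 'cV[R]_N) :
  psd K ->
  quad K (\sum_(i < n) a i *: v i) (\sum_(i < n) a i *: v i) <=
    (2 ^+ n * \sum_(i < n) a i ^+ 2) * \sum_(i < n) quad K (v i) (v i).
Proof.
move=> pK; have [_ K0] := pK; elim: n => [|n IH].
  by rewrite !big_ord0 mulr0 quad0l.
rewrite !big_ord_recr /=; apply: le_trans (quad_sqrD _ _ pK) _.
rewrite quadZl quadZr; move: IH.
set q := quad K (\sum_(i < n) _) _; set X := \sum_(i < n) a i ^+ 2.
set Y := \sum_(i < n) quad K _ _; set P := 2 ^+ n => IH; rewrite exprS -/P.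
have P1 : 1 <= P by rewrite exprn_ege1// ler1n.
have X0 : 0 <= X by apply: sumr_ge0 => i _; exact: sqr_ge0.
have Y0 : 0 <= Y by apply: sumr_ge0 => i _; exact: K0.
have := K0 (v n); move: (quad K (v n) (v n)) => b b0.
have := sqr_ge0 (a n); rewrite [a n * (_ * _)]mulrA -expr2; move: (a n ^+ 2) => t t0.
have h1 : t * b <= P * (t * b) by rewrite ler_peMl// mulr_ge0.
have h2 : 0 <= P * (t * Y) by rewrite !mulr_ge0// (le_trans ler01).
have h3 : 0 <= P * (X * b) by rewrite !mulr_ge0// (le_trans ler01).
lra.
Qed.

(* [v] lists the iterates backwards in time, [v 0] being the newest one. *)
Lemma bdf_gstable k : (1 <= k <= 5)%N ->
  exists (G : forall N, 'M[R]_N -> (nat -> 'cV[R]_N) -> R) (gam Gam : R),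
  [/\ 0 < gam, 0 <= Gam &
  forall N (K : 'M[R]_N), psd K -> forall v,
  [/\ gam * quad K (v 0%N) (v 0%N) <= G N K v,
      G N K v <= Gam * \sum_(i < k) quad K (v i) (v i),
      G N K v - G N K (v \o succn) <=
        quad K (v 0%N - 9 / 10 *: v 1%N) (\sum_(j < k.+1) bdf_coef R k j *: v j) &
      forall (K' : 'M[R]_N) c, (forall x, quad K x x <= c * quad K' x x) ->
        G N K v <= c * G N K' v]].
Proof.
move=> hk; have := bdf_checked hk; rewrite /bdf_check.
have dE j : (j <= k)%N -> _ := @bdf_coefE k j hk.
case: (bdf_table k) dE => d s S D dE.
have {}dE j : (j <= k)%N -> 60 * bdf_coef R k j = zr (nth Z0 d j) := dE j.
case/and5P => s0 /eqP sd SD0 sS /and3P[sD hS chk].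
have {}s0 : 0 < zr s by exact: zr_gt0.
move: SD0; rewrite all_cat => /andP[S0 D0].
have sosp T N (K : 'M[R]_N) v : psd K -> all (fun p => Z.ltb 0 p.1) T ->
    0 <= sos T K v.
  move=> [_ pK] /allP T0; rewrite /sos big_seq sumr_ge0// => p pT.
  by rewrite mulr_ge0// ltW// zr_gt0// T0.
pose Gam := \sum_(p <- S) zr p.1 * (2 ^+ size p.2 *
  \sum_(i < size p.2) zr (nth Z0 p.2 i) ^+ 2).
exists (fun N K v => (zr s)^-1 * sos S K v).
exists ((zr s)^-1 * zr (head (Z0, [::]) S).1), ((zr s)^-1 * Gam).
have Gam0 : 0 <= Gam.
  rewrite /Gam big_seq sumr_ge0// => p pS.
  rewrite !mulr_ge0 ?exprn_ge0//; last by apply: sumr_ge0 => i _; exact: sqr_ge0.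
  by rewrite ltW// zr_gt0// (allP S0).
split.
- rewrite mulr_gt0 ?invr_gt0//; case: (S) hS S0 => // p r _ /=.
  by case/andP => /zr_gt0.
- by rewrite mulr_ge0// invr_ge0 ltW.
move=> N K pK v; have [sK K0] := pK; split.
- rewrite -mulrA ler_wpM2l ?invr_ge0 ?(ltW s0)//.
  case: (S) hS S0 => // -[w [//|x r]] r' /andP[/eqP -> /allP r0] /andP[w0 S0'] /=.
  have v0E : lcomb (Zpos xH :: r) v = v 0%N.
    rewrite /lcomb /= big_ord_recl /= rmorph1 scale1r big1 ?addr0// => i _.
    have /r0/eqP <- : nth Z0 r i \in r by rewrite mem_nth.
    by rewrite rmorph0 scale0r.
  by rewrite /sos big_cons /= v0E lerDl; exact: sosp.
- rewrite -mulrA ler_wpM2l ?invr_ge0 ?(ltW s0)//.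
  rewrite /sos /Gam big_distrl big_seq [leRHS]big_seq; apply: ler_sum => p pS /=.
  rewrite -mulrA ler_wpM2l//; first by rewrite ltW// zr_gt0// (allP S0).
  by rewrite -(eqP (allP sS p pS)); exact: (quad_lincomb_le _ (fun i => zr (nth Z0 p.2 i)) v pK).
- set S' := map _ _ in chk.
  have sos' : sos S K (v \o succn) = sos S' K v.
    by rewrite /sos big_map; apply: eq_bigr => p _ /=; rewrite lcomb_cons0.
  have sS1 : all (fun p : Z * seq Z => size p.2 <= k.+1)%N S.
    by apply: sub_all sS => p /eqP ->.
  have sS2 : all (fun p : Z * seq Z => size p.2 <= k.+1)%N S'.
    by rewrite all_map; apply: sub_all sS => p /eqP /= ->.
  have sD1 : all (fun p : Z * seq Z => size p.2 <= k.+1)%N D.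
    by apply: sub_all sD => p /eqP ->.
  pose mu : seq Z := [:: Zpos 10; Zneg 9].
  have multE : v 0%N - 9 / 10 *: v 1%N =
      10^-1 *: \sum_(i < k.+1) zr (nth Z0 mu i) *: v i.
    case: (k) hk => // k' _; rewrite !big_ord_recl big1 => [|i _].
      rewrite addr0 /zr /= /Pos.to_nat /= NegzE mulrNz -!pmulrn scalerDr.
      by rewrite !scalerA -scaleNr -[v 0%N in LHS]scale1r;
        congr (_ *: _ + _ *: _); lra.
    by rewrite nth_default ?rmorph0 ?scale0r.
  have bdfE : \sum_(j < k.+1) bdf_coef R k j *: v j =
      60^-1 *: \sum_(j < k.+1) zr (nth Z0 d j) *: v j.
    rewrite scaler_sumr; apply: eq_bigr => j _.
    rewrite -dE; last by rewrite -ltnS ltn_ord.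
    rewrite scalerA; congr (_ *: _); lra.
  rewrite sos' multE bdfE quadZl quadZr.
  rewrite (quad_sum2 K k.+1 (fun i => zr (nth Z0 mu i)) (fun i => zr (nth Z0 d i))).
  set Q := \sum_(i < _) _.
  suff QE : 2 * zr s * Q + 1200 * sos S' K v = 1200 * (sos S K v + sos D K v).
    have := sosp D N K v pK D0.
    have -> : 10^-1 * (60^-1 * Q) =
        (zr s)^-1 * (sos S K v - sos S' K v + sos D K v).
      apply: (mulfI (lt0r_neq0 s0)); rewrite mulVKf ?gt_eqF//; lra.
    by rewrite -mulrBr ler_pM2l ?invr_gt0//; lra.
  have QE : 2 * Q = \sum_(i < k.+1) \sum_(j < k.+1)
      (zr (nth Z0 mu i) * zr (nth Z0 d j) + zr (nth Z0 mu j) * zr (nth Z0 d i)) *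
        quad K (v i) (v j).
    rewrite mulr_natl mulr2n {2}/Q exchange_big -big_split.
    apply: eq_bigr => i _; rewrite -big_split; apply: eq_bigr => j _ /=.
    by rewrite (quad_sym (v j)) // mulrDl.
  rewrite mulrAC QE (sosE K v sS1) (sosE K v sS2) (sosE K v sD1).
  rewrite mulr_suml !mulr_sumr mulrDr !mulr_sumr -!big_split.
  apply: eq_bigr => i _; rewrite mulr_suml !mulr_sumr -!big_split.
  apply: eq_bigr => j _ /=.
  have := allP (allP chk i _) j _; rewrite !mem_iota !add0n !ltn_ord.
  move=> /(_ isT isT)/eqP/(congr1 zr).
  rewrite !(zrD, zrM).
  have -> : zr (Zpos 1200) = 1200 by [].
  move=> /(congr1 ( *%R (quad K (v i) (v j)))); rewrite -/mu; lra.
- move=> K' c hc; rewrite mulrCA ler_wpM2l ?invr_ge0 ?(ltW s0)//.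
  rewrite /sos mulr_sumr big_seq [leRHS]big_seq; apply: ler_sum => p pS.
  rewrite mulrCA ler_wpM2l//.
  by rewrite ltW// zr_gt0// (allP S0).
Qed.

End GStability.

(** * Energy estimate *)

Section DiscreteEnergy.
Variable R : realType.

Lemma ler_sum_shift (m : nat -> R) k i n : (i <= k <= n)%N ->
  (forall j, (j <= n)%N -> 0 <= m j) ->
  \sum_(k.+1 <= j < n.+1) m (j - i)%N <= \sum_(0 <= j < n.+1) m j.
Proof.
move=> /andP[ik kn] m0; have ik1 : (i <= k.+1)%N by rewrite leqW.
rewrite -{1}(subnK ik1) big_addn.
under eq_bigr do rewrite addnK.
rewrite (@big_cat_nat _ _ _ (k.+1 - i) 0 n.+1)//=; last first.
  by rewrite (leq_trans (leq_subr _ _)).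
rewrite (@big_cat_nat _ _ _ (n.+1 - i) (k.+1 - i) n.+1)//= ?leq_sub2r//;
  last by rewrite leq_subr.
rewrite addrCA lerDl addr_ge0// big_nat_cond sumr_ge0// => j;
  rewrite andbT => /andP[h1 h2]; apply: m0; lia.
Qed.

Lemma discrete_gronwall (m : nat -> R) (X q : R) n0 n : 0 <= X -> 0 <= q ->
  (forall j, (n0 <= j < n)%N -> m j <= X + q * \sum_(n0 <= i < j) m i) ->
  X + q * \sum_(n0 <= i < n) m i <= X * (1 + q) ^+ (n - n0).
Proof.
move=> X0 q0; elim: n => [|n IH] hm; first by rewrite big_geq// mulr0 addr0 mulr1.
have [n0n|nn0] := leqP n0 n; last first.
  by rewrite big_geq// mulr0 addr0 (eqP nn0) mulr1.
have {}IH := IH _; have := hm n; rewrite n0n ltnSn => /(_ isT) mn.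
rewrite big_nat_recr//= subSn// exprSr mulrA mulrDr addrA.
apply: (@le_trans _ _ ((X + q * \sum_(n0 <= i < n) m i) * (1 + q))).
  rewrite mulrDr mulr1 lerD2l mulrC ler_wpM2r//.
apply: ler_wpM2r; first by rewrite addr_ge0.
apply: IH => j /andP[j1 j2]; apply: hm; rewrite j1/=; exact: ltnW.
Qed.

Lemma discrete_energy (k : nat) (gam c0 c3 c4 c5 c6 T : R) :
  (0 < k)%N -> 0 < gam -> 0 < c0 -> 0 <= c3 -> 0 <= c4 -> 0 <= c5 -> 0 <= c6 ->
  exists C : R, forall (tau beta mx : R) (m a D g : nat -> R) (n : nat),
  0 < tau <= 1 -> tau * (k.+1%:R * c3) <= gam / 2 -> 0 <= beta <= 1 ->
  (k <= n)%N -> n%:R * tau <= T ->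
  (forall j, (j <= n)%N -> [/\ 0 <= m j, 0 <= a j & 0 <= D j]) ->
  0 <= mx -> (forall j, (j < k)%N -> m j <= mx) ->
  m k + tau * a k <= c5 * (mx + tau * D k) ->
  g k <= c6 * (m k + mx) ->
  (forall j, (k <= j <= n)%N -> gam * m j <= g j) ->
  (forall j, (k <= j < n)%N -> g j.+1 <= g j + tau *
     (c3 * (\sum_(i < k.+1) m (j.+1 - i)%N) + c4 * D j.+1
      - (beta + c0) * a j.+1 + beta * a j)) ->
  m n + tau * (\sum_(k <= j < n.+1) a j) <=
    C * tau * (\sum_(k <= j < n.+1) D j) + C * mx.
Proof.
move=> k0 gam0 c00 c30 c40 c50 c60.
pose c8 := k.+1%:R * c3; pose cX := c6 * (c5 + 1) + c5 + c4 + c8 * k%:R.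
pose E := expR (2 * c8 * T / gam).
exists (cX * E / gam + cX * E / c0 + c5).
move=> tau beta mx m a D g n /andP[tau0 tau1] htau /andP[b0 b1] kn nT pos mx0
  mmx first gk gm step.
have c80 : 0 <= c8 by rewrite mulr_ge0.
have m0 j : (j <= n)%N -> 0 <= m j by case/pos.
have a0 j : (j <= n)%N -> 0 <= a j by case/pos.
have D0 j : (j <= n)%N -> 0 <= D j by case/pos.
set SD := \sum_(k <= j < n.+1) D j.
pose Y := mx + tau * SD.
have SDE : SD = D k + \sum_(k.+1 <= i < n.+1) D i by rewrite /SD big_ltn// ltnS.
have Dsum j : (j <= n)%N -> \sum_(k.+1 <= i < j.+1) D i <= SD - D k.
  move=> jn; rewrite SDE addrC addKr.
  have [kj|jk] := leqP k j; last first.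
    rewrite big_geq ?ltnS ?(ltnW jk)// big_nat_cond sumr_ge0// => i.
    by rewrite andbT => /andP[_]; rewrite ltnS => /D0.
  rewrite (@big_cat_nat _ _ _ j.+1 k.+1 n.+1)//= lerDl.
  by rewrite big_nat_cond sumr_ge0// => i; rewrite andbT => /andP[_]; rewrite ltnS => /D0.
have Y0 : 0 <= Y.
  rewrite addr_ge0// mulr_ge0// ?(ltW tau0)// /SD big_nat_cond sumr_ge0// => i.
  by rewrite andbT => /andP[_]; rewrite ltnS => /D0.
have Dk : D k <= SD.
  by have := Dsum k kn; rewrite big_geq// subr_ge0.
have firstY : m k + tau * a k <= c5 * Y.
  apply: le_trans first _; rewrite ler_wpM2l// lerD2l ler_wpM2l// ltW//.
have mk : m k <= c5 * Y by have := mulr_ge0 (ltW tau0) (a0 k kn); lra.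
have ak : tau * a k <= c5 * Y by have := m0 k kn; lra.
pose X := cX * Y.
have summed j : (k <= j <= n)%N ->
    gam * m j + c0 * (tau * \sum_(k.+1 <= i < j.+1) a i) <=
    X + c8 * tau * \sum_(k <= i < j.+1) m i.
  move=> /andP[kj jn].
  pose W l := \sum_(i < k.+1) m (l - i)%N.
  have key : g j + beta * (tau * a j) + c0 * (tau * \sum_(k.+1 <= i < j.+1) a i) <=
      g k + beta * (tau * a k) + tau * (c3 * \sum_(k.+1 <= l < j.+1) W l)
      + tau * (c4 * \sum_(k.+1 <= l < j.+1) D l).
    elim: j kj jn => [|j IH] kj jn; first by move: kj; rewrite leqNgt k0.
    move: kj; rewrite leq_eqVlt => /orP[/eqP <-|kj].
      by rewrite !big_geq// !mulr0 !addr0.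
    rewrite ltnS in kj.
    have := IH kj (ltnW jn); have := step j; rewrite kj jn => /(_ isT).
    rewrite -/(W j.+1) !(@big_nat_recr _ _ _ j.+1)//=.
    lra.
  have Wsum : \sum_(k.+1 <= l < j.+1) W l <= k.+1%:R * \sum_(0 <= i < j.+1) m i.
    rewrite /W exchange_big/= -[X in X%:R]card_ord mulr_natl -sumr_const.
    apply: ler_sum => i _; apply: ler_sum_shift => [|l lj].
      by rewrite -ltnS ltn_ord kj.
    by apply: m0; apply: leq_trans jn.
  have msum : \sum_(0 <= i < j.+1) m i <= k%:R * mx + \sum_(k <= i < j.+1) m i.
    rewrite (@big_cat_nat _ _ _ k)//= ?(leqW kj)// lerD2r big_mkord.
    rewrite -[X in X%:R]card_ord mulr_natl -sumr_const.
    by apply: ler_sum => i _; exact: mmx.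
  have h1 : tau * (c3 * \sum_(k.+1 <= l < j.+1) W l) <=
      c8 * k%:R * Y + c8 * tau * \sum_(k <= i < j.+1) m i.
    have : tau * (c3 * \sum_(k.+1 <= l < j.+1) W l) <=
      tau * (c3 * (k.+1%:R * (k%:R * mx + \sum_(k <= i < j.+1) m i))).
      rewrite ler_wpM2l ?(ltW tau0)// ler_wpM2l//.
      by apply: le_trans Wsum _; rewrite ler_wpM2l.
    move/le_trans; apply; rewrite /c8.
    have h : tau * (c8 * k%:R * mx) <= c8 * k%:R * Y.
      rewrite mulrCA ler_wpM2l ?mulr_ge0//.
      apply: le_trans (_ : mx <= _); first by rewrite ler_piMl.
      by rewrite lerDl mulr_ge0 ?(ltW tau0)//; have := Dk; have := D0 k kn; lra.
    rewrite /c8 in h; lra.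
  have h2 : tau * (c4 * \sum_(k.+1 <= l < j.+1) D l) <= c4 * Y.
    rewrite mulrCA ler_wpM2l// /Y ler_wpDl// ler_wpM2l ?(ltW tau0)//.
    by have := Dsum j jn; have := D0 k kn; lra.
  have h3 : g k <= c6 * (c5 + 1) * Y.
    apply: le_trans gk _; rewrite -mulrA ler_wpM2l// mulrDl mul1r lerD//.
    by rewrite lerDl mulr_ge0 ?(ltW tau0)//; have := Dk; have := D0 k kn; lra.
  have h4 : beta * (tau * a k) <= c5 * Y.
    by apply: le_trans ak; rewrite ler_piMl// mulr_ge0 ?(ltW tau0)// a0.
  have h5 : 0 <= beta * (tau * a j).
    by rewrite !mulr_ge0 ?(ltW tau0)// a0.
  have := gm j; rewrite kj jn => /(_ isT).
  rewrite /X /cX; lra.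
have X0 : 0 <= X by rewrite !mulr_ge0// !addr_ge0// !mulr_ge0// addr_ge0.
pose q := 2 * c8 * tau / gam.
pose V j := \sum_(k <= i < j) m i.
have a_ge0 j : (j <= n)%N -> 0 <= c0 * (tau * \sum_(k.+1 <= i < j.+1) a i).
  move=> jn; rewrite !mulr_ge0 ?(ltW tau0) ?(ltW c00)//.
  rewrite big_nat_cond sumr_ge0// => i; rewrite andbT => /andP[_]; rewrite ltnS => ij.
  by apply: a0; apply: leq_trans jn.
have c8tau : c8 * tau <= gam / 2 by rewrite mulrC.
have mj j : (k <= j < n.+1)%N -> m j <= 2 * X / gam + q * V j.
  move=> /andP[kj jn]; have := summed j; rewrite kj -ltnS jn => /(_ isT).
  rewrite (@big_nat_recr _ _ _ j k)//= => h; have := a_ge0 j jn; have := m0 j jn => mj0 aj0.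
  have h1 : c8 * tau * m j <= gam / 2 * m j by rewrite ler_wpM2r.
  have -> : 2 * X / gam + q * V j = (X + c8 * tau * V j) / (gam / 2).
    by rewrite /q; field; rewrite gt_eqF.
  rewrite ler_pdivlMr ?divr_gt0//; rewrite /V; lra.
have q0 : 0 <= q by rewrite /q !mulr_ge0 ?invr_ge0 ?(ltW tau0) ?(ltW gam0).
have Xg0 : 0 <= 2 * X / gam by rewrite divr_ge0 ?(ltW gam0)// mulr_ge0.
have gr := discrete_gronwall Xg0 q0 mj.
have {}gr : X + c8 * tau * V n.+1 <= X * E.
  have -> : X + c8 * tau * V n.+1 = (2 * X / gam + q * V n.+1) * (gam / 2).
    by rewrite /q; field; rewrite gt_eqF.
  apply: le_trans (_ : 2 * X / gam * (1 + q) ^+ (n.+1 - k) * (gam / 2) <= _).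
    by rewrite ler_wpM2r ?divr_ge0 ?(ltW gam0).
  rewrite mulrAC (_ : 2 * X / gam * (gam / 2) = X); last by field; rewrite gt_eqF.
  rewrite ler_wpM2l//.
  apply: le_trans (_ : expR q ^+ (n.+1 - k) <= _).
    by rewrite lerXn2r ?nnegrE ?addr_ge0 ?expR_ge0// expR_ge1Dx.
  rewrite -expRM_natl /E ler_expR.
  apply: le_trans (_ : n%:R * q <= _).
    by rewrite ler_wpM2r// ler_nat leq_subLR -add1n leq_add2r.
  rewrite /q (_ : n%:R * (2 * c8 * tau / gam) = 2 * c8 * (n%:R * tau) / gam);
    last by field; rewrite gt_eqF.
  by rewrite ler_wpM2r ?invr_ge0 ?(ltW gam0)// ler_wpM2l// mulr_ge0.
have fin := summed n; rewrite kn leqnn /= in fin.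
have {}fin := le_trans (fin isT) gr.
have hm : m n <= X * E / gam.
  by rewrite ler_pdivlMr// mulrC; have := a_ge0 n (leqnn n); lra.
have ha : tau * \sum_(k.+1 <= i < n.+1) a i <= X * E / c0.
  rewrite ler_pdivlMr// mulrC.
  by have := mulr_ge0 (ltW gam0) (m0 n (leqnn n)); lra.
rewrite (big_ltn (m := k)) ?ltnS//.
have -> : (cX * E / gam + cX * E / c0 + c5) * tau * SD
  + (cX * E / gam + cX * E / c0 + c5) * mx =
  X * E / gam + X * E / c0 + c5 * Y by rewrite /X /Y; ring.
lra.
Qed.

End DiscreteEnergy.

Section BdfStep.
Variables (R : realType) (k N : nat) (mu kappa om T tau : R).
Variables (M A B : R -> 'M[R]_N) (e : nat -> 'cV[R]_N).
Hypotheses (k_gt0 : (0 < k)%N) (tau_gt0 : 0 < tau) (tau_le1 : tau <= 1).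
Hypothesis M_psd : forall t : R, 0 <= t <= T -> psd (M t).
Hypothesis A_psd : forall t : R, 0 <= t <= T -> psd (A t).
Hypothesis AM_unit : forall t : R, 0 <= t <= T -> A t + M t \in unitmx.
Hypothesis B_bound : forall t : R, 0 <= t <= T -> forall y z (s : R), 0 < s ->
  quad (B t) z y <= s / 2 * om ^+ 2 * quad (M t) y y +
                    (2 * s)^-1 * quad (A t) z z.
Hypothesis M_growth : growth_bound T M mu.
Hypothesis A_growth : growth_bound T A kappa.

Let tn (n : nat) : R := n%:R * tau.
Let m (n : nat) : R := quad (M (tn n)) (e n) (e n).
Let a (n : nat) : R := quad (A (tn n)) (e n) (e n).
Let d := bdf_residual k tau M A B e.
Let D (n : nat) : R := dual_norm2 (M (tn n)) (A (tn n)) (d n).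
Let Ee : R := expR (`|mu| * k%:R).
Let c1 : R := `|mu| * k%:R * Ee.
Let Sd : R := \sum_(j < k.+1) `|bdf_coef R k j|.
Let W (n : nat) : R := \sum_(i < k.+1) m (n - i)%N.

Lemma expR_sub1_le (x : R) : expR x - 1 <= x * expR x.
Proof.
have := expR_ge1Dx (- x); have := expRxMexpNx_1 x; have := expR_gt0 x.
move: (expR x) (expR (- x)) => p q; nra.
Qed.

Lemma tn_in n n' : (n <= n')%N -> tn n' <= T -> 0 <= tn n <= T.
Proof.
move=> nn' hT; rewrite mulr_ge0 ?(ltW tau_gt0)//=; apply: le_trans hT.
by rewrite ler_wpM2r ?(ltW tau_gt0)// ler_nat.
Qed.

Lemma dist_tn n i : (i <= n)%N -> `|tn (n - i) - tn n| = i%:R * tau.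
Proof.
move=> ni; rewrite /tn -mulrBl natrB// addrAC subrr sub0r normrM normrN.
by rewrite normr_nat gtr0_norm.
Qed.

Lemma Ee_ge1 : 1 <= Ee.
Proof. by rewrite -expR0 ler_expR mulr_ge0. Qed.

Lemma c1_ge0 : 0 <= c1.
Proof. by rewrite !mulr_ge0// expR_ge0. Qed.

Lemma growth_factor_le i : (i <= k)%N -> expR (`|mu| * (i%:R * tau)) <= Ee.
Proof.
move=> ik; rewrite ler_expR ler_wpM2l//.
apply: le_trans (_ : i%:R * 1 <= _); last by rewrite mulr1 ler_nat.
by rewrite ler_wpM2l.
Qed.

Lemma growth_factor_sub1 i : (i <= k)%N ->
  expR (`|mu| * (i%:R * tau)) - 1 <= c1 * tau.
Proof.
move=> ik; apply: le_trans (expR_sub1_le _) _.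
have -> : c1 * tau = (`|mu| * (k%:R * tau)) * Ee by rewrite /c1; ring.
apply: ler_pM.
- by rewrite !mulr_ge0// ltW.
- exact: expR_ge0.
- by rewrite ler_wpM2l// ler_wpM2r ?(ltW tau_gt0)// ler_nat.
- by have := growth_factor_le ik.
Qed.

Lemma M_shift n i x : (i <= k)%N -> (i <= n)%N -> tn n <= T ->
  quad (M (tn n)) x x <= Ee * quad (M (tn (n - i))) x x.
Proof.
move=> ik ni nT; have tiT := tn_in (leq_subr i n) nT.
apply: le_trans (growth_quad x M_growth (M_psd tiT) (tn_in (leqnn n) nT) tiT) _.
rewrite ler_wpM2r ?(M_psd tiT).2// distrC dist_tn//; exact: growth_factor_le.
Qed.

Lemma M_shift_rev n i x : (i <= k)%N -> (i <= n)%N -> tn n <= T ->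
  quad (M (tn (n - i))) x x <= Ee * quad (M (tn n)) x x.
Proof.
move=> ik ni nT; have tnT := tn_in (leqnn n) nT.
apply: le_trans (growth_quad x M_growth (M_psd tnT) (tn_in (leq_subr i n) nT) tnT) _.
rewrite ler_wpM2r ?(M_psd tnT).2// dist_tn//; exact: growth_factor_le.
Qed.

Lemma M_shift_sub n i x y : (i <= k)%N -> (i <= n)%N -> tn n <= T ->
  `|quad (M (tn (n - i)) - M (tn n)) x y| <=
  c1 * tau * ((quad (M (tn n)) x x + quad (M (tn n)) y y) / 2).
Proof.
move=> ik ni nT; have tnT := tn_in (leqnn n) nT.
apply: le_trans (growth_quad_sub x y M_growth (M_psd tnT) (tn_in (leq_subr i n) nT) tnT) _.
rewrite ler_wpM2r ?divr_ge0 ?addr_ge0 ?(M_psd tnT).2// dist_tn//.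
exact: growth_factor_sub1.
Qed.

Lemma dual_young n z (s : R) : tn n <= T -> 0 < s ->
  quad 1%:M z (d n) <= s * (quad (A (tn n)) z z + quad (M (tn n)) z z)
    + (4 * s)^-1 * D n.
Proof.
move=> nT s0; have tnT := tn_in (leqnn n) nT.
have [sM pM] := M_psd tnT; have [sA pA] := A_psd tnT.
set K := A (tn n) + M (tn n); have uK := AM_unit tnT.
have pK : psd K.
  split=> [|x]; first by rewrite /K linearD /= sM sA.
  by rewrite quad_mxD addr_ge0.
pose x := invmx K *m d n.
have dE : d n = K *m x by rewrite mulKVmx.
have -> : D n = quad K x x.
  rewrite /D /dual_norm2 -/K {2}dE quad_mulmx mulVmx// /quad mulmx1.
  by rewrite [in LHS]dE trmx_mul pK.1.
have -> : quad 1%:M z (d n) = quad K z x by rewrite dE quad1_mulmx.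
rewrite -quad_mxD -/K; have s2 : 0 < 2 * s by rewrite mulr_gt0.
have := quad_young z x pK s2.
have -> : 2 * s / 2 = s by field.
by rewrite mulrA -natrM.
Qed.

Lemma bdf_test n z :
  \sum_(j < k.+1) bdf_coef R k j * quad (M (tn (n - j))) z (e (n - j)%N) =
  tau * (quad 1%:M z (d n) - quad (A (tn n)) z (e n) - quad (B (tn n)) z (e n)).
Proof.
rewrite /d /bdf_residual -!/(tn _) !quadDr !quad1_mulmx quadZr quad_sumr.
rewrite [X in tau * (X - _)]addrAC !addrK mulVKf ?gt_eqF//; apply: eq_bigr => j _.
by rewrite quadZr quad1_mulmx.
Qed.

Lemma m_ge0 n : tn n <= T -> 0 <= m n.
Proof. by move=> nT; apply: (M_psd (tn_in (leqnn n) nT)).2. Qed.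

Lemma a_ge0 n : tn n <= T -> 0 <= a n.
Proof. by move=> nT; apply: (A_psd (tn_in (leqnn n) nT)).2. Qed.

Lemma D_ge0 n : tn n <= T -> 0 <= D n.
Proof.
move=> nT; have := @dual_young n 0 4^-1 nT; rewrite !quad0l addr0 mulr0 add0r.
by rewrite mulfV// invr1 mul1r; apply; rewrite invr_gt0.
Qed.

Lemma m_le_W n i : tn n <= T -> (i <= k)%N -> m (n - i) <= W n.
Proof.
move=> nT ik; rewrite /W (bigD1 (Ordinal (ik : (i < k.+1)%N)))//= lerDl.
rewrite sumr_ge0// => j _; apply: m_ge0.
by have /andP[] := tn_in (leq_subr j n) nT.
Qed.

Variables (G : 'M[R]_N -> (nat -> 'cV[R]_N) -> R) (gam Gam : R).
Hypothesis Gam_ge0 : 0 <= Gam.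
Hypothesis G_stable : forall K, psd K -> forall v,
  [/\ gam * quad K (v 0%N) (v 0%N) <= G K v,
      G K v <= Gam * \sum_(i < k) quad K (v i) (v i),
      G K v - G K (v \o succn) <=
        quad K (v 0%N - 9 / 10 *: v 1%N) (\sum_(j < k.+1) bdf_coef R k j *: v j) &
      forall K' c, (forall x, quad K x x <= c * quad K' x x) ->
        G K v <= c * G K' v].
Let Ek : R := expR (`|kappa| * tau).
Hypothesis A_factor : Ek <= 11 / 10.

Let g (n : nat) : R := G (M (tn n)) (fun i => e (n - i)%N).
Let beta : R := 37 / 80 * Ek.
Let c3 : R := 5 / 2 * Sd * c1 * Ee + Ee + 80 * om ^+ 2 + c1 * Gam * Ee.

Lemma Sd_ge0 : 0 <= Sd.
Proof. by apply: sumr_ge0. Qed.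

Lemma dist_tnS n : `|tn n.+1 - tn n| = tau /\ `|tn n - tn n.+1| = tau.
Proof.
have h : tn n.+1 - tn n = tau by rewrite /tn -mulrBl -natrB// subSnn mul1r.
by split; [|rewrite distrC]; rewrite h gtr0_norm.
Qed.

Lemma bdf_step n : (k <= n)%N -> tn n.+1 <= T ->
  g n.+1 <= g n + tau * (c3 * W n.+1 + 80 * D n.+1
                         - (beta + 40^-1) * a n.+1 + beta * a n).
Proof.
move=> kn nT; have nT' := tn_in (leqnn n.+1) nT.
have /andP[tn0 tnT] := tn_in (leqnSn n) nT.
have tnin : 0 <= tn n <= T by rewrite tn0.
have kn1 : (k <= n.+1)%N := leqW kn.
have [pM pA] := (M_psd nT', A_psd nT').
pose v i := e (n.+1 - i)%N; pose z := v 0%N - 9 / 10 *: v 1%N.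
have W0 : 0 <= W n.+1.
  by rewrite sumr_ge0// => i _; apply: m_ge0; have /andP[] := tn_in (leq_subr i n.+1) nT.
have mW : m n.+1 <= W n.+1 by have := m_le_W nT (leq0n k); rewrite subn0.
have mW1 : m n <= W n.+1 by have := m_le_W nT k_gt0; rewrite subn1.
have mM : quad (M (tn n.+1)) (e n) (e n) <= Ee * m n.
  by have := M_shift (e n) k_gt0 (ltn0Sn n) nT; rewrite subn1.
have zM : quad (M (tn n.+1)) z z <= 4 * Ee * W n.+1.
  apply: le_trans (quad_sqrD _ _ pM) _.
  rewrite quadNl quadNr opprK quadZl quadZr /v subn0 subn1 /=.
  have h1 : Ee * m n <= Ee * W n.+1 by rewrite ler_wpM2l// expR_ge0.
  have h2 : W n.+1 <= Ee * W n.+1 by rewrite ler_peMl// Ee_ge1.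
  have := pM.2 (e n); rewrite -/(m n.+1); lra.
have aA : quad (A (tn n.+1)) (e n) (e n) <= Ek * a n.
  have := growth_quad (e n) A_growth (A_psd tnin) nT' tnin.
  by rewrite (dist_tnS n).1.
set a' := quad (A (tn n.+1)) (e n) (e n) in aA.
have a'0 : 0 <= a' by exact: pA.2.
have zA : quad (A (tn n.+1)) z z <= 2 * a n.+1 + 2 * a'.
  apply: le_trans (quad_sqrD _ _ pA) _.
  rewrite quadNl quadNr opprK quadZl quadZr /v subn0 subn1 /= -/(a n.+1) -/a'; lra.
have cross : - quad (A (tn n.+1)) z (e n.+1) <= - (11 / 20) * a n.+1 + 9 / 20 * a'.
  have := quad_young (e n) (e n.+1) pA ltr01.
  rewrite quadDl quadNl quadZl /v subn0 subn1 /= -/(a n.+1) -/a'; lra.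
have bB : - quad (B (tn n.+1)) z (e n.+1) <=
    80 * om ^+ 2 * W n.+1 + 320^-1 * quad (A (tn n.+1)) z z.
  have s0 : 0 < 160 :> R by rewrite ltr0n.
  have := B_bound nT' (- e n.+1) z s0; rewrite !quadNr quadNl opprK -/(m n.+1).
  have : om ^+ 2 * m n.+1 <= om ^+ 2 * W n.+1 by rewrite ler_wpM2l// sqr_ge0.
  lra.
have dD : quad 1%:M z (d n.+1) <= 320^-1 * (quad (A (tn n.+1)) z z
    + quad (M (tn n.+1)) z z) + 80 * D n.+1.
  have s0 : 0 < 320^-1 :> R by rewrite invr_gt0 ltr0n.
  have := dual_young z nT s0.
  by have -> : (4 * 320^-1)^-1 = 80 :> R by field.
have [_ Gup Gd _] := G_stable pM v.
have main : quad (M (tn n.+1)) z (\sum_(j < k.+1) bdf_coef R k j *: v j) <=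
    tau * (quad 1%:M z (d n.+1) - quad (A (tn n.+1)) z (e n.+1)
           - quad (B (tn n.+1)) z (e n.+1)) +
    c1 * tau * Sd * (5 / 2 * Ee * W n.+1).
  rewrite -bdf_test quad_sumr /Sd -mulrA mulr_suml mulr_sumr -big_split.
  apply: ler_sum => j _ /=; rewrite quadZr.
  have jk : (j <= k)%N by rewrite -ltnS.
  have jn : (j <= n.+1)%N := leq_trans jk kn1.
  have sh := M_shift_sub z (v j) jk jn nT.
  have vM : quad (M (tn n.+1)) (v j) (v j) <= Ee * W n.+1.
    apply: le_trans (M_shift (v j) jk jn nT) _.
    by rewrite ler_wpM2l ?expR_ge0// m_le_W.
  rewrite quad_mxD quad_mxN -/(v j) in sh *.
  have h : `|quad (M (tn (n.+1 - j))) z (v j) - quad (M (tn n.+1)) z (v j)| <=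
      c1 * tau * (5 / 2 * Ee * W n.+1).
    apply: le_trans sh _; rewrite ler_wpM2l//; last by lra.
    exact: mulr_ge0 c1_ge0 (ltW tau_gt0).
  rewrite -lerBlDl -mulrBr; apply: le_trans (ler_norm _) _.
  rewrite normrM distrC mulrCA ler_wpM2l//.
have Gprev : G (M (tn n.+1)) (v \o succn) <= g n + tau * (c1 * Gam * Ee * W n.+1).
  have [_ Gup' _ _] := G_stable (M_psd tnin) (fun i => e (n - i)%N).
  have [_ _ _ Gmono] := G_stable pM (v \o succn).
  have := Gmono (M (tn n)) (expR (`|mu| * tau)).
  have -> : v \o succn = (fun i => e (n - i)%N) by apply/funext => i; rewrite /v/= subSS.
  rewrite -/(g n) => /(_ _)/le_trans; apply=> [x|].
    have := growth_quad x M_growth (M_psd tnin) nT' tnin.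
    by rewrite (dist_tnS n).1.
  have f1 : expR (`|mu| * tau) - 1 <= c1 * tau.
    by have := growth_factor_sub1 k_gt0; rewrite mul1r.
  have f0 : 0 <= expR (`|mu| * tau) - 1.
    by rewrite subr_ge0 -expR0 ler_expR mulr_ge0// ltW.
  have gW : g n <= Gam * (Ee * W n.+1).
    apply: le_trans Gup' _; rewrite ler_wpM2l//.
    rewrite /W big_ord_recl /= mulrDr ler_wpDl ?mulr_ge0 ?expR_ge0//.
      by rewrite subn0 m_ge0.
    rewrite mulr_sumr; apply: ler_sum => i _.
    rewrite /bump leq0n add1n subSS; apply: M_shift => //; first exact: ltnW.
    by rewrite (leq_trans _ kn)// ltnW.
  have gW' : 0 <= Gam * (Ee * W n.+1) by rewrite !mulr_ge0// expR_ge0.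
  have h1 := ler_wpM2l f0 gW; have h2 := ler_wpM2r gW' f1; lra.
have br : quad 1%:M z (d n.+1) - quad (A (tn n.+1)) z (e n.+1)
           - quad (B (tn n.+1)) z (e n.+1) <=
    (Ee + 80 * om ^+ 2) * W n.+1 + 80 * D n.+1
      - (beta + 40^-1) * a n.+1 + beta * a n.
  have h1 : 37 / 80 * a' <= beta * a n by rewrite /beta; lra.
  have h2 : (beta + 40^-1) * a n.+1 <= 43 / 80 * a n.+1.
    apply: ler_wpM2r; first exact: a_ge0.
    by have := A_factor; rewrite /beta; lra.
  have h3 : 0 <= Ee * W n.+1 by rewrite mulr_ge0// expR_ge0.
  lra.
have := ler_wpM2l (ltW tau_gt0) br.
rewrite -/(g n.+1) in Gd; rewrite /c3; lra.
Qed.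

Lemma bdf_first : tn k <= T -> 1 <= bdf_coef R k 0 -> tau * om ^+ 2 <= 8^-1 ->
  tau <= 2^-1 -> forall mx, (forall i, (i < k)%N -> m i <= mx) ->
  m k + tau * a k <= 2 * (Sd * (Sd + 1) * Ee + 1) * (mx + tau * D k).
Proof.
move=> kT d01 tom tau2 mx mmx.
have kT' := tn_in (leqnn k) kT; have pA := A_psd kT'.
have mk := m_ge0 kT; have ak := a_ge0 kT; have Dk := D_ge0 kT.
have mx0 : 0 <= mx.
  by apply: le_trans (mmx 0%N k_gt0); apply: m_ge0; have /andP[] := tn_in (leq0n k) kT.
have := bdf_test k (e k); rewrite big_ord_recl subn0 -/(m k) -/(a k).
set Z := \sum_(i < k) _.
have bB : - quad (B (tn k)) (e k) (e k) <= om ^+ 2 * m k + 4^-1 * a k.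
  have s0 : 0 < 2 :> R by [].
  have := B_bound kT' (- e k) (e k) s0; rewrite !quadNr quadNl opprK -/(m k) -/(a k).
  lra.
have dD : quad 1%:M (e k) (d k) <= 4^-1 * (a k + m k) + D k.
  have s0 : 0 < 4^-1 :> R by rewrite invr_gt0.
  have := dual_young (e k) kT s0.
  have -> : (4 * 4^-1)^-1 = 1 :> R by field.
  by rewrite mul1r.
have Zb : - Z <= 4^-1 * m k + Sd * (Sd + 1) * Ee * mx.
  have S0 := Sd_ge0; have E1 := Ee_ge1.
  pose s := (2 * (Sd + 1) * Ee)^-1.
  have s0 : 0 < s by rewrite invr_gt0 !mulr_gt0//; lra.
  have Zb1 : - Z <= Sd * (s / 2 * (Ee * m k) + (2 * s)^-1 * mx).
    have h0 : 0 <= s / 2 * (Ee * m k) + (2 * s)^-1 * mx.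
      apply: addr_ge0; apply: mulr_ge0 => //.
      - by rewrite divr_ge0// ltW.
      - by rewrite mulr_ge0// (le_trans ler01).
      - by rewrite invr_ge0 mulr_ge0// ltW.
    rewrite /Sd big_ord_recl mulrDl mulr_suml -sumrN ler_wpDl ?mulr_ge0//.
    apply: ler_sum => i _ /=.
    have ik : (bump 0 i <= k)%N by rewrite /bump leq0n add1n ltn_ord.
    have kiT := tn_in (leq_subr (bump 0 i) k) kT.
    rewrite -mulrN; apply: le_trans (ler_norm _) _; rewrite normrM ler_wpM2l// normrN.
    have h1 := M_shift_rev (e k) ik ik kT.
    have h2 : m (k - bump 0 i) <= mx by apply: mmx; rewrite ltn_subrL /bump leq0n add1n k_gt0.
    have y1 := quad_young (e k) (e (k - bump 0 i)%N) (M_psd kiT) s0.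
    have y2 := quad_young (e k) (- e (k - bump 0 i)%N) (M_psd kiT) s0.
    rewrite !quadNr quadNl opprK -/(m _) in y1 y2.
    have h3 : s / 2 * quad (M (tn (k - bump 0 i))) (e k) (e k) <= s / 2 * (Ee * m k).
      by rewrite ler_wpM2l// divr_ge0// ltW.
    have h4 : (2 * s)^-1 * m (k - bump 0 i) <= (2 * s)^-1 * mx.
      by rewrite ler_wpM2l// invr_ge0 mulr_ge0// ltW.
    by rewrite ler_norml; lra.
  apply: le_trans Zb1 _.
  have -> : (2 * s)^-1 = (Sd + 1) * Ee.
    by rewrite /s; field; rewrite !gt_eqF//; lra.
  have -> : s / 2 * (Ee * m k) = m k / (4 * (Sd + 1)).
    by rewrite /s; field; rewrite !gt_eqF//; lra.
  have h : Sd * (m k / (4 * (Sd + 1))) <= 4^-1 * m k.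
    rewrite mulrA ler_pdivrMr; last by lra.
    have := mulr_ge0 S0 mk; lra.
  lra.
move=> test.
have h1 := ler_wpM2l (ltW tau_gt0) bB; have h2 := ler_wpM2l (ltW tau_gt0) dD.
have h3 : tau * om ^+ 2 * m k <= 8^-1 * m k by rewrite ler_wpM2r.
have h4 : tau * m k <= 2^-1 * m k by rewrite ler_wpM2r.
have h5 : m k <= bdf_coef R k 0 * m k by rewrite ler_peMl.
have h6 : 0 <= Sd * (Sd + 1) * Ee * (tau * D k).
  by rewrite !mulr_ge0 ?addr_ge0 ?Sd_ge0 ?expR_ge0 ?(ltW tau_gt0).
have h7 := mulr_ge0 (ltW tau_gt0) Dk.
lra.
Qed.

End BdfStep.

Lemma bdf_coef0_ge1 (R : realType) k : (1 <= k <= 5)%N -> 1 <= bdf_coef R k 0.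
Proof.
rewrite /bdf_coef /bdf_poly coef_sum => hk.
under eq_bigr do rewrite coefZ coef_1subXn bin0.
case: k hk => [//|k _]; rewrite big_ltn//= invr1 mul1r lerDl sumr_ge0// => i _.
by rewrite mulr1 invr_ge0.
Qed.

Lemma ler_bigmax_ord (R : realType) n (F : nat -> R) i : (i < n)%N ->
  F i <= \big[Num.max/0]_(j < n) F j.
Proof. by move=> ni; apply: (le_bigmax _ (fun j : 'I_n => F j) (Ordinal ni)). Qed.

Theorem bdf_stability (R : realType) (k : nat) (hk : (1 <= k <= 5)%N)
    (mu kappa om : R) :
  exists tau0 : R, 0 < tau0 /\
  forall T : R, exists C : R,
  forall (N : nat) (M A B : R -> 'M[R]_N),
  (forall t : R, 0 <= t <= T -> psd (M t)) ->
  (forall t : R, 0 <= t <= T -> psd (A t)) ->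
  (forall t : R, 0 <= t <= T -> A t + M t \in unitmx) ->
  (forall t : R, 0 <= t <= T -> forall y z (s : R), 0 < s ->
    quad (B t) z y <= s / 2 * om ^+ 2 * quad (M t) y y +
                      (2 * s)^-1 * quad (A t) z z) ->
  growth_bound T M mu -> growth_bound T A kappa ->
  forall (tau : R) (e d : nat -> 'cV[R]_N), 0 < tau <= tau0 ->
  forall n, (k <= n)%N -> n%:R * tau <= T ->
  (forall j, (k <= j <= n)%N -> bdf_residual k tau M A B e j = d j) ->
  mxnorm (M (n%:R * tau)) (e n) ^+ 2
    + tau * (\sum_(k <= j < n.+1) mxnorm (A (j%:R * tau)) (e j) ^+ 2)
  <= C * tau * (\sum_(k <= j < n.+1)
                  dual_norm2 (M (j%:R * tau)) (A (j%:R * tau)) (d j))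
    + C * \big[Num.max/0]_(i < k) (mxnorm (M (i%:R * tau)) (e i) ^+ 2).
Proof.
have /andP[k0 k5] := hk.
have [G [gam [Gam [gam0 Gam0 Gst]]]] := @bdf_gstable R k hk.
pose Ee : R := expR (`|mu| * k%:R); pose c1 : R := `|mu| * k%:R * Ee.
pose Sd : R := \sum_(j < k.+1) `|bdf_coef R k j|.
pose c3 : R := 5 / 2 * Sd * c1 * Ee + Ee + 80 * om ^+ 2 + c1 * Gam * Ee.
have Ee0 : 0 <= Ee by exact: expR_ge0.
have c10 : 0 <= c1 by rewrite !mulr_ge0.
have Sd0 : 0 <= Sd by apply: sumr_ge0.
have om0 : 0 <= om ^+ 2 := sqr_ge0 om.
have c30 : 0 <= c3.
  by rewrite /c3; move: (om ^+ 2) om0 => o2 o20; rewrite !addr_ge0// !mulr_ge0.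
pose K3 : R := k.+1%:R * c3; have K30 : 0 <= K3 by rewrite mulr_ge0.
pose xk : R := `|kappa| * expR `|kappa|.
have xk0 : 0 <= xk by rewrite mulr_ge0// expR_ge0.
pose tau0 : R := Num.min (Num.min 2^-1 (gam / (2 * (1 + K3))))
  (Num.min (10 * (1 + xk))^-1 (8 * (1 + om ^+ 2))^-1).
exists tau0; split.
  by rewrite !lt_min divr_gt0 ?invr_gt0 ?mulr_gt0 ?ltr_pwDl ?ltr0n.
move=> T.
pose c5 : R := 2 * (Sd * (Sd + 1) * Ee + 1); pose c6 : R := Gam * Ee * k%:R.
have c50 : 0 <= c5 by rewrite !mulr_ge0// addr_ge0// !mulr_ge0// addr_ge0.
have c60 : 0 <= c6 by rewrite !mulr_ge0.
have [||C HC] := @discrete_energy R k gam 40^-1 c3 80 c5 c6 T k0 gam0 _ c30 _ c50 c60.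
- by rewrite invr_gt0 ltr0n.
- by rewrite ler0n.
exists C => N M A B Mp Ap AMu Bb Mg Ag tau e d /andP[t0 ttau0] n kn nT res.
pose tn (j : nat) : R := j%:R * tau.
move: ttau0; rewrite /tau0 !le_min => /andP[/andP[t1 t2] /andP[t3 t4]].
have tle1 : tau <= 1 by apply: le_trans t1 _; rewrite invf_le1// ler1n.
have tn_le j : (j <= n)%N -> tn j <= T.
  by move=> jn; apply: le_trans nT; rewrite ler_wpM2r ?(ltW t0)// ler_nat.
have tn_T j : (j <= n)%N -> 0 <= tn j <= T.
  by move=> jn; rewrite tn_le// andbT mulr_ge0// ltW.
pose m j := quad (M (tn j)) (e j) (e j).
pose a j := quad (A (tn j)) (e j) (e j).
pose D j := dual_norm2 (M (tn j)) (A (tn j)) (bdf_residual k tau M A B e j).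
pose mx := \big[Num.max/0]_(i < k) m i.
have -> : \big[Num.max/0]_(i < k) (mxnorm (M (tn i)) (e i) ^+ 2) = mx.
  apply: eq_bigr => i _; apply: mxnorm_sqr; apply/Mp/tn_T.
  by rewrite (leq_trans _ kn)// ltnW.
rewrite mxnorm_sqr; last exact/Mp/tn_T.
have -> : \sum_(k <= j < n.+1) mxnorm (A (tn j)) (e j) ^+ 2 =
    \sum_(k <= j < n.+1) a j.
  by apply: eq_big_nat => j /andP[_ jn]; apply: mxnorm_sqr; exact/Ap/tn_T.
have -> : \sum_(k <= j < n.+1) dual_norm2 (M (tn j)) (A (tn j)) (d j) =
    \sum_(k <= j < n.+1) D j.
  by apply: eq_big_nat => j /andP[kj jn]; rewrite /D res// kj.
have mmx j : (j < k)%N -> m j <= mx by exact: ler_bigmax_ord.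
have mx0 : 0 <= mx by rewrite /mx; exact: bigmax_ge_id.
have Ak : expR (`|kappa| * tau) <= 11 / 10.
  have h := expR_sub1_le (`|kappa| * tau).
  have h1 : `|kappa| * tau * expR (`|kappa| * tau) <= tau * xk.
    rewrite /xk -mulrA mulrCA ler_wpM2l ?(ltW t0)// ler_wpM2l// ler_expR.
    by rewrite ler_piMr.
  have h2 : tau * (10 * (1 + xk)) <= 1 by rewrite -ler_pdivlMr ?div1r//; lra.
  lra.
have tom : tau * om ^+ 2 <= 8^-1.
  have h2 : tau * (8 * (1 + om ^+ 2)) <= 1 by rewrite -ler_pdivlMr ?div1r//; lra.
  lra.
have tK : tau * K3 <= gam / 2.
  have h2 : tau * (2 * (1 + K3)) <= gam by rewrite -ler_pdivlMr//; lra.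
  lra.
pose g j := G N (M (tn j)) (fun i => e (j - i)%N).
pose beta : R := 37 / 80 * expR (`|kappa| * tau).
apply: (HC tau beta mx m a D g n) => //.
- by rewrite t0.
- by have := expR_ge0 (`|kappa| * tau); rewrite /beta; lra.
- move=> j jn; split.
  + exact: m_ge0 (tn_le j jn).
  + exact: a_ge0 (tn_le j jn).
  + exact: D_ge0 (tn_le j jn).
- exact (bdf_first k0 t0 tle1 Mp Ap AMu Bb Mg (tn_le k kn)
    (bdf_coef0_ge1 R hk) tom t1 mmx).
- have [_ Gup _ _] := Gst N (M (tn k)) (Mp _ (tn_T k kn)) (fun i => e (k - i)%N).
  apply: le_trans Gup _; rewrite /c6 -!mulrA ler_wpM2l//.
  have -> : Ee * (k%:R * (m k + mx)) = \sum_(i < k) Ee * (m k + mx).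
    by rewrite sumr_const card_ord -[in RHS]mulr_natl mulrCA.
  apply: ler_sum => i _; have ik : (i <= k)%N by rewrite ltnW.
  apply: le_trans (M_shift t0 tle1 Mp Mg (e (k - i)%N) ik ik (tn_le k kn)) _.
  rewrite ler_wpM2l// -/(m _); have mk : 0 <= m k := m_ge0 e t0 Mp (tn_le k kn).
  case: (posnP i) => [->|i0]; first by rewrite subn0; lra.
  have : m (k - i)%N <= mx by apply: mmx; rewrite ltn_subrL i0 k0.
  lra.
- move=> j /andP[kj jn].
  have [Glow _ _ _] := Gst N (M (tn j)) (Mp _ (tn_T j jn)) (fun i => e (j - i)%N).
  by rewrite subn0 in Glow.
- move=> j /andP[kj jn].
  exact (bdf_step e k0 t0 tle1 Mp Ap AMu Bb Mg Ag Gam0 (Gst N) Ak kj (tn_le _ jn)).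
Qed.

(** * Finite element matrices *)

Section UnitSimplex.
Variable R : realType.
Implicit Types (n : nat).

Let measurable_coord n (i : 'I_n) :
  measurable_fun setT (fun xi : n.-tuple (measurableTypeR R) => tnth xi i : R).
Proof. exact: measurable_tnth. Qed.

Lemma measurable_setle d (T : measurableType d) (f g : T -> R) :
  measurable_fun setT f -> measurable_fun setT g ->
  measurable [set x | f x <= g x].
Proof.
move=> mf mg; have := measurable_fun_ler mf mg measurableT (_ : measurable [set true]).
by rewrite setTI => /(_ _); apply.
Qed.

Definition cube n (c : R) : set (n.-tuple (measurableTypeR R)) :=
  [set xi | forall i, 0 <= tnth xi i <= c].
Arguments cube : clear implicits.

Lemma measurable_cube n c : measurable (cube n c).
Proof.
have -> : cube n c = \big[setI/setT]_(i < n)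
    ([set xi | 0 <= (tnth xi i : R)] `&` [set xi | (tnth xi i : R) <= c]).
  rewrite -bigcap_seq; apply/seteqP; split=> xi /= h.
    by move=> i _; apply/andP; exact: h.
  by move=> i; have [|h1 h2] := h i; [rewrite /= mem_index_enum|apply/andP].
apply: bigsetI_measurable => i _; apply: measurableI.
  by apply: measurable_setle => //; exact: measurable_coord.
by apply: measurable_setle => //; exact: measurable_coord.
Qed.

Lemma lebesgue_cube n c : 0 <= c -> lebesgue_tuple R n (cube n c) = (c ^+ n)%:E.
Proof.
move=> c0; elim: n => [|n IH].
  by rewrite expr0 [LHS]diracE mem_set// => -[].
have -> : lebesgue_tuple R n.+1 (cube n.+1 c) =
    (lebesgue_tuple R n \x (@lebesgue_measure R))%E
      (@cons_pair R n @^-1` cube n.+1 c) by [].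
have -> : @cons_pair R n @^-1` cube n.+1 c = cube n c `*` `[0, c]%classic.
  apply/seteqP; split=> -[xi x] /= h; first split=> [i|] /=.
  - by have := h (lift ord0 i); rewrite tnthS.
  - by have := h ord0; rewrite tnth0 in_itv.
  - move=> i; case: (unliftP ord0 i) => [j|] ->; first by rewrite tnthS; apply: h.1.
    by rewrite tnth0; have := h.2; rewrite /= in_itv.
rewrite product_measure1E//; last exact: measurable_cube.
rewrite IH; rewrite [X in (_ * X)%E](_ : _ = @lebesgue_measure R `[0, c]%classic)//.
rewrite lebesgue_measure_itv /= lte_fin exprSr EFinM; case: ltP => [_|c0'].
  by rewrite oppr0 adde0.
by have -> : c = 0 by apply/eqP; rewrite eq_le c0 c0'.
Qed.

Lemma measurable_unit_simplex n : measurable (unit_simplex R n).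
Proof.
have -> : unit_simplex R n = \big[setI/setT]_(i < n)
    [set xi | 0 <= (tnth xi i : R)] `&` [set xi | \sum_(i < n) (tnth xi i : R) <= 1].
  rewrite -bigcap_seq; apply/seteqP; split=> xi /= -[h1 h2]; split=> // i.
    by move=> _; exact: h1.
  by apply: h1; rewrite /= mem_index_enum.
apply: measurableI.
  apply: bigsetI_measurable => i _.
  by apply: measurable_setle => //; exact: measurable_coord.
apply: measurable_setle => //; apply: measurable_sum => i; exact: measurable_coord.
Qed.

Lemma unit_simplex_coord_le1 n xi (i : 'I_n) : unit_simplex R n xi ->
  0 <= (tnth xi i : R) <= 1.
Proof.
move=> [h1 h2]; rewrite h1/=; apply: le_trans h2.
by rewrite (bigD1 i)//= lerDl sumr_ge0.
Qed.

Lemma lebesgue_unit_simplex_lty n :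
  (lebesgue_tuple R n (unit_simplex R n) < +oo)%E.
Proof.
apply: (@le_lt_trans _ _ (lebesgue_tuple R n (cube n 1))).
  apply: le_measure; rewrite ?inE; [exact: measurable_unit_simplex|exact: measurable_cube|].
  by move=> xi h i; exact: unit_simplex_coord_le1.
by rewrite lebesgue_cube// ltry.
Qed.

Lemma lebesgue_unit_simplex_gt0 n :
  0 < fine (lebesgue_tuple R n (unit_simplex R n)).
Proof.
rewrite fine_gt0// lebesgue_unit_simplex_lty andbT.
apply: (@lt_le_trans _ _ (lebesgue_tuple R n (cube n n.+1%:R^-1))).
  by rewrite lebesgue_cube ?invr_ge0// lte_fin exprn_gt0// invr_gt0.
apply: le_measure; rewrite ?inE; [exact: measurable_cube|exact: measurable_unit_simplex|].
move=> xi h; split=> [i|]; first by have /andP[] := h i.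
apply: (@le_trans _ _ (\sum_(i < n) n.+1%:R^-1)).
  by apply: ler_sum => i _; have /andP[] := h i.
by rewrite sumr_const card_ord -[leLHS]mulr_natl ler_pdivrMr// mul1r ler_nat.
Qed.

Section Integral.
Variable n : nat.
Local Notation T := (n.-tuple (measurableTypeR R)).
Local Notation D := (unit_simplex R n).

Definition simplex_int (f : T -> R) : R := Rintegral (lebesgue_tuple R n) D f.

Definition tame (f : T -> R) : Prop :=
  measurable_fun setT f /\ exists C, forall xi, D xi -> `|f xi| <= C.

Lemma tame_cst c : tame (fun=> c).
Proof. by split=> //; exists `|c|. Qed.

Lemma tameD f g : tame f -> tame g -> tame (fun xi => f xi + g xi).
Proof.
move=> [mf [C hC]] [mg [C' hC']]; split; first exact: measurable_funD.
by exists (C + C') => xi h; rewrite (le_trans (ler_normD _ _))// lerD ?hC ?hC'.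
Qed.

Lemma tameM f g : tame f -> tame g -> tame (fun xi => f xi * g xi).
Proof.
move=> [mf [C hC]] [mg [C' hC']]; split; first exact: measurable_funM.
by exists (C * C') => xi h; rewrite normrM ler_pM ?hC ?hC'.
Qed.

Lemma tame_sum (I : Type) (r : seq I) (F : I -> T -> R) :
  (forall i, tame (F i)) -> tame (fun xi => \sum_(i <- r) F i xi).
Proof.
move=> tF; elim: r => [|i r IH].
  by under [X in tame X]funext do rewrite big_nil; exact: tame_cst.
by under [X in tame X]funext do rewrite big_cons; exact: tameD.
Qed.

Lemma tame_coord i : tame (fun xi => tnth xi i : R).
Proof.
split; first exact: measurable_coord.
by exists 1 => xi /unit_simplex_coord_le1 -/(_ i)/andP[h1 h2]; rewrite ger0_norm.
Qed.

Lemma tame_integrable f : tame f -> (lebesgue_tuple R n).-integrable D (EFin \o f).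
Proof.
move=> [mf [C hC]]; apply: measurable_bounded_integrable.
- exact: measurable_unit_simplex.
- exact: lebesgue_unit_simplex_lty.
- exact: measurable_funS mf.
- exists C; split; first exact: num_real.
  by move=> x Cx xi h; apply: le_trans (hC _ h) (ltW _).
Qed.

Lemma simplex_intD f g : tame f -> tame g ->
  simplex_int (fun xi => f xi + g xi) = simplex_int f + simplex_int g.
Proof.
by move=> tf tg; apply: RintegralD;
  [exact: measurable_unit_simplex|exact: tame_integrable|exact: tame_integrable].
Qed.

Lemma simplex_intZ c f : tame f ->
  simplex_int (fun xi => c * f xi) = c * simplex_int f.
Proof.
by move=> tf; apply: RintegralZl; [exact: measurable_unit_simplex|exact: tame_integrable].
Qed.

Lemma simplex_int_le f g : tame f -> tame g -> (forall xi, D xi -> f xi <= g xi) ->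
  simplex_int f <= simplex_int g.
Proof.
move=> tf tg h; apply: le_Rintegral => //;
  [exact: measurable_unit_simplex|exact: tame_integrable|exact: tame_integrable].
Qed.

Lemma eq_simplex_int f g : (forall xi, D xi -> f xi = g xi) ->
  simplex_int f = simplex_int g.
Proof. by move=> fg; apply: eq_Rintegral => xi; rewrite inE => /fg. Qed.

Lemma simplex_int_cst c :
  simplex_int (fun=> c) = c * fine (lebesgue_tuple R n D).
Proof. by rewrite /simplex_int Rintegral_cst//; exact: measurable_unit_simplex. Qed.

Lemma simplex_int_ge0 f : (forall xi, D xi -> 0 <= f xi) -> 0 <= simplex_int f.
Proof. exact: Rintegral_ge0. Qed.

Lemma simplex_int_sum (I : Type) (r : seq I) (F : I -> T -> R) :
  (forall i, tame (F i)) ->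
  simplex_int (fun xi => \sum_(i <- r) F i xi) = \sum_(i <- r) simplex_int (F i).
Proof.
move=> tF; elim: r => [|i r IH].
  rewrite big_nil -[RHS](mul0r (fine (lebesgue_tuple R n D))) -simplex_int_cst.
  by apply: eq_simplex_int => xi _; rewrite big_nil.
rewrite big_cons -IH -simplex_intD//; last exact: tame_sum.
by apply: eq_simplex_int => xi _; rewrite big_cons.
Qed.

End Integral.

End UnitSimplex.

Section Dot.
Variables (R : realType) (n : nat).
Implicit Types (u v w : 'rV[R]_n).

Lemma dotvE u v : dotv u v = \sum_i u 0 i * v 0 i.
Proof. by rewrite /dotv mxE; apply: eq_bigr => i _; rewrite mxE. Qed.

Lemma dotvC u v : dotv u v = dotv v u.
Proof. by rewrite !dotvE; apply: eq_bigr => i _; rewrite mulrC. Qed.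

Lemma dotvDl u v w : dotv (u + v) w = dotv u w + dotv v w.
Proof. by rewrite /dotv mulmxDl mxE. Qed.

Lemma dotvZl c u v : dotv (c *: u) v = c * dotv u v.
Proof. by rewrite /dotv -scalemxAl mxE. Qed.

Lemma dotvDr u v w : dotv u (v + w) = dotv u v + dotv u w.
Proof. by rewrite dotvC dotvDl !(dotvC _ u). Qed.

Lemma dotvZr c u v : dotv u (c *: v) = c * dotv u v.
Proof. by rewrite dotvC dotvZl dotvC. Qed.

Lemma dotv_suml (I : Type) (r : seq I) (F : I -> 'rV[R]_n) v :
  dotv (\sum_(i <- r) F i) v = \sum_(i <- r) dotv (F i) v.
Proof. by rewrite /dotv mulmx_suml summxE. Qed.

Lemma dotv_sumr (I : Type) (r : seq I) (F : I -> 'rV[R]_n) v :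
  dotv v (\sum_(i <- r) F i) = \sum_(i <- r) dotv v (F i).
Proof. by rewrite dotvC dotv_suml; apply: eq_bigr => i _; rewrite dotvC. Qed.

Lemma dotvv_ge0 u : 0 <= dotv u u.
Proof. by rewrite dotvE sumr_ge0// => i _; rewrite -expr2 sqr_ge0. Qed.

Lemma dotvv_eq0 u : dotv u u = 0 -> u = 0.
Proof.
rewrite dotvE => /eqP; rewrite psumr_eq0 => [|i _]; last by rewrite -expr2 sqr_ge0.
move=> /allP h; apply/rowP => i; rewrite mxE; apply/eqP.
by have := h i; rewrite mem_index_enum mulf_eq0 orbb => /(_ isT).
Qed.

Lemma dotv_young u v (c s : R) : 0 < s ->
  c * dotv u v <= s / 2 * (c ^+ 2 * dotv u u) + (2 * s)^-1 * dotv v v.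
Proof.
move=> s0; have := dotvv_ge0 ((s * c) *: u + (-1) *: v).
rewrite dotvDl !dotvDr !dotvZl !dotvZr (dotvC v u) => h.
have -> : s / 2 * (c ^+ 2 * dotv u u) + (2 * s)^-1 * dotv v v = c * dotv u v +
  (2 * s)^-1 * (s * c * (s * c * dotv u u) + s * c * (-1 * dotv u v) +
                (-1 * (s * c * dotv u v) + -1 * (-1 * dotv v v))).
  by field; rewrite gt_eqF.
by rewrite lerDl mulr_ge0// invr_ge0 mulr_ge0// ltW.
Qed.

Lemma dotv_convex (I : finType) (b : I -> R) (d : I -> 'rV[R]_n) (c : R) :
  (forall i, 0 <= b i) -> \sum_i b i = 1 -> (forall i, dotv (d i) (d i) <= c) ->
  dotv (\sum_i b i *: d i) (\sum_i b i *: d i) <= c.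
Proof.
move=> b0 b1 dc; set W := \sum_i _.
have h : \sum_i b i * dotv (d i - W) (d i - W) =
    \sum_i b i * dotv (d i) (d i) - dotv W W.
  under eq_bigr => i _.
    rewrite -scaleN1r dotvDl !dotvDr !dotvZl !dotvZr (dotvC W (d i)).
    rewrite (_ : b i * _ = b i * dotv (d i) (d i) + -2 * (b i * dotv (d i) W) +
      b i * dotv W W); last by ring.
    over.
  rewrite !big_split /= -mulr_suml b1 mul1r -mulr_sumr.
  have -> : \sum_i b i * dotv (d i) W = dotv W W.
    by rewrite {2}/W dotv_suml; apply: eq_bigr => i _; rewrite dotvZl.
  ring.
have h1 : 0 <= \sum_i b i * dotv (d i - W) (d i - W).
  by apply: sumr_ge0 => i _; rewrite mulr_ge0 ?dotvv_ge0.
have h2 : \sum_i b i * dotv (d i) (d i) <= c.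
  rewrite -[leRHS]mul1r -b1 mulr_suml; apply: ler_sum => i _.
  by rewrite ler_wpM2l.
lra.
Qed.

End Dot.

Lemma quad_eq0_unitmx (R : realType) N (K : 'M[R]_N) :
  (forall x, quad K x x = 0 -> x = 0) -> K \in unitmx.
Proof.
move=> h; rewrite -row_free_unit -kermx_eq0; apply/eqP/row_matrixP => i.
rewrite row0; apply: trmx_inj; rewrite trmx0; apply: h.
by rewrite /quad trmxK -row_mul mulmx_ker row0 mul0mx mxE.
Qed.

Section Gram.
Variables (R : realType) (m : nat) (E : 'M[R]_(m, m.+1)).
Hypothesis freeE : row_free E.

Lemma gram_unitmx : E *m E^T \in unitmx.
Proof.
apply: quad_eq0_unitmx => x h; apply: trmx_inj; rewrite trmx0.
have : dotv (x^T *m E) (x^T *m E) = 0.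
  by rewrite -h /dotv /quad trmx_mul trmxK !mulmxA.
move/dotvv_eq0 => xE; apply: (row_free_inj freeE).
by rewrite xE mul0mx.
Qed.

(* Completing [E] by a row orthogonal to its rows gives a square matrix whose
   squared determinant is the Gram determinant times a squared length. *)
Lemma det_gram_gt0 : 0 < \det (E *m E^T).
Proof.
have : kermx E^T != 0.
  rewrite kermx_eq0 /row_free mxrank_tr (eqP freeE).
  by rewrite neq_ltn ltnSn.
case/rowV0Pn => nu /sub_kermxP nuE nu0.
pose F : 'M[R]_(1 + m, 1 + m) := col_mx nu E.
have nuE' : E *m nu^T = 0.
  by apply: trmx_inj; rewrite trmx_mul trmxK nuE trmx0.
have FF : F *m F^T = block_mx (nu *m nu^T) 0 0 (E *m E^T).
  by rewrite /F tr_col_mx mul_col_row nuE nuE'.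
have nn : 0 < \det (nu *m nu^T).
  rewrite det_mx11 lt_neqAle dotvv_ge0 andbT eq_sym.
  by apply: contra nu0 => /eqP/dotvv_eq0 ->.
have dd : \det F ^+ 2 = \det (nu *m nu^T) * \det (E *m E^T).
  by rewrite -(det_ublock _ 0) -FF det_mulmx det_tr.
rewrite lt_neqAle eq_sym -unitfE -unitmxE gram_unitmx /=.
by rewrite -(pmulr_rge0 _ nn) -dd sqr_ge0.
Qed.

End Gram.

Section Barycentric.
Variables (R : realType) (m N : nat) (a : 'I_N -> 'rV[R]_m.+1)
  (K : 'I_m.+1 -> 'I_N).
Local Notation D := (unit_simplex R m).
Implicit Types (xi : m.-tuple (measurableTypeR R)) (f : 'rV[R]_m.+1 -> R).

Lemma convex_comb_simplex n (lam : 'I_n -> R) (q : 'I_n -> 'I_m.+1) :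
  (forall i, 0 <= lam i) -> \sum_i lam i = 1 ->
  simplex a K (\sum_i lam i *: a (K (q i))).
Proof.
move=> lam0 lam1; exists (fun j => \sum_(i | K (q i) == j) lam i); split.
- by move=> j; apply: sumr_ge0.
- move=> j jK; apply: big1 => i /eqP ij; case/negP: jK.
  by rewrite -ij; exact: codom_f.
- by rewrite -lam1 (partition_big (K \o q) xpredT).
rewrite (partition_big (K \o q) xpredT)//=; apply: eq_bigr => j _.
by rewrite scaler_suml; apply: eq_bigr => i /eqP ->.
Qed.

Lemma affine_convex_comb f n (lam : 'I_n -> R) (q : 'I_n -> 'I_m.+1) :
  affine_on_simplex a K f -> (forall i, 0 <= lam i) -> \sum_i lam i = 1 ->
  f (\sum_i lam i *: a (K (q i))) = \sum_i lam i * f (a (K (q i))).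
Proof.
move=> af; elim: n lam q => [|n IH] lam q lam0.
  by rewrite big_ord0 => /eqP; rewrite eq_sym oner_eq0.
rewrite !big_ord_recl; set s := \sum_(i < n) _ => lam1.
have s0 : 0 <= s by apply: sumr_ge0.
have vert i : simplex a K (a (K i)).
  have := @convex_comb_simplex 1 (fun=> 1) (fun=> i).
  by rewrite !big_ord1 scale1r; apply.
have [sz|sn0] := eqVneq s 0.
  have lz i : lam (lift ord0 i) = 0.
    by apply/eqP; move/eqP: sz; rewrite psumr_eq0// => /allP /(_ i);
      rewrite mem_index_enum => /(_ isT).
  have l1 : lam ord0 = 1 by rewrite -lam1 sz addr0.
  rewrite l1 scale1r mul1r !big1 ?addr0// => i _; first by rewrite lz mul0r.
  by rewrite lz scale0r.
have sE : s = 1 - lam ord0 by rewrite -lam1 addrC addKr.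
pose mu i := lam (lift ord0 i) / s.
have mu0 i : 0 <= mu i by rewrite divr_ge0.
have mu1 : \sum_i mu i = 1 by rewrite -mulr_suml divff.
have -> : \sum_(i < n) lam (lift ord0 i) *: a (K (q (lift ord0 i))) =
    (1 - lam ord0) *: \sum_(i < n) mu i *: a (K (q (lift ord0 i))).
  rewrite scaler_sumr -sE; apply: eq_bigr => i _.
  by rewrite scalerA /mu mulrC divfK.
rewrite af; first last.
- by rewrite lam0 -lam1 lerDl.
- exact: convex_comb_simplex.
- exact: vert.
rewrite (IH mu (q \o lift ord0))// -sE mulr_sumr; congr (_ + _).
by apply: eq_bigr => i _; rewrite mulrA /mu mulrCA divff// mulr1.
Qed.

Definition bary xi (i : 'I_m.+1) : R :=
  if unlift ord0 i is Some j then tnth xi j else 1 - \sum_j (tnth xi j : R).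

Lemma bary0 xi : bary xi ord0 = 1 - \sum_j (tnth xi j : R).
Proof. by rewrite /bary unlift_none. Qed.

Lemma bary_lift xi j : bary xi (lift ord0 j) = tnth xi j.
Proof. by rewrite /bary liftK. Qed.

Lemma bary_ge0 xi i : D xi -> 0 <= bary xi i.
Proof.
by move=> [h1 h2]; case: (unliftP ord0 i) => [j|] ->;
  rewrite ?bary_lift ?bary0 ?subr_ge0.
Qed.

Lemma sum_bary xi : \sum_i bary xi i = 1.
Proof.
rewrite big_ord_recl (eq_bigr (fun j => tnth xi j : R)) => [|j _]; last exact: bary_lift.
by rewrite bary0 subrK.
Qed.

Lemma tame_bary i : tame (fun xi => bary xi i).
Proof.
case: (unliftP ord0 i) => [j|] ->.
  have -> : bary^~ (lift ord0 j) = fun xi => tnth xi j : R.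
    by apply/funext => xi; exact: bary_lift.
  exact: tame_coord.
have -> : bary^~ ord0 = fun xi => 1 + -1 * \sum_j (tnth xi j : R).
  by apply/funext => xi; rewrite bary0 mulN1r.
apply: tameD; first exact: tame_cst.
by apply: tameM; [exact: tame_cst | apply: tame_sum => j; exact: tame_coord].
Qed.

Lemma elt_map_bary xi : elt_map a K xi = \sum_i bary xi i *: a (K i).
Proof.
rewrite /elt_map big_ord_recl bary0 scalerBl scale1r -addrA; congr (_ + _).
rewrite mulmx_sum_row scaler_suml -sumrN -big_split; apply: eq_bigr => i _ /=.
by rewrite bary_lift mxE rowK scalerBr addrC.
Qed.

Lemma affine_elt_map f xi : affine_on_simplex a K f -> D xi ->
  f (elt_map a K xi) = \sum_i bary xi i * f (a (K i)).
Proof.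
move=> af h; rewrite elt_map_bary (affine_convex_comb id af)//.
- by move=> i; exact: bary_ge0.
- exact: sum_bary.
Qed.

End Barycentric.

Section FiniteElements.
Variables (R : realType) (m N L : nat) (a : 'I_N -> 'rV[R]_m.+1)
  (elt : 'I_L -> 'I_m.+1 -> 'I_N) (chi : 'I_N -> 'rV[R]_m.+1 -> R).
Hypotheses (tri : triangulation a elt) (nb : nodal_basis a elt chi).
Local Notation D := (unit_simplex R m).
Local Notation T := (m.-tuple (measurableTypeR R)).
Implicit Types (xi : T) (p : 'I_L) (j k : 'I_N) (y z : 'cV[R]_N).

Let volD : R := fine (lebesgue_tuple R m D).

Definition vol p : R := Num.sqrt (\det (gram a (elt p))).

Lemma vol_gt0 p : 0 < vol p.
Proof.
have [_ /(_ p)[_ fr] _ _ _] := tri.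
by rewrite sqrtr_gt0; exact: det_gram_gt0.
Qed.

(* [hat p j] is the pull-back of [chi j] to the reference simplex. *)
Definition hat p j xi : R := \sum_(i | elt p i == j) bary xi i.

Lemma chi_elt_map p j xi : D xi -> chi j (elt_map a (elt p) xi) = hat p j xi.
Proof.
have [_ /(_ p) af kr] := nb j.
move=> h; rewrite (affine_elt_map af h) /hat [RHS]big_mkcond.
by apply: eq_bigr => i _; rewrite kr; case: eqP; rewrite ?mulr1 ?mulr0.
Qed.

Lemma tame_hat p j : tame (hat p j).
Proof.
have -> : hat p j = fun xi => \sum_i (elt p i == j)%:R * bary xi i.
  apply/funext => xi; rewrite /hat big_mkcond; apply: eq_bigr => i _.
  by case: eqP; rewrite ?mul1r ?mul0r.
by apply: tame_sum => i; apply: tameM; [exact: tame_cst | exact: tame_bary].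
Qed.

Lemma hat_ge0 p j xi : D xi -> 0 <= hat p j xi.
Proof. by move=> h; apply: sumr_ge0 => i _; exact: bary_ge0. Qed.

Lemma sum_hat p xi : \sum_j hat p j xi = 1.
Proof. by rewrite -(sum_bary xi) [RHS](partition_big (elt p) xpredT). Qed.

Definition fe_fun p z xi : R := \sum_j z j 0 * hat p j xi.

Lemma tame_fe_fun p z : tame (fe_fun p z).
Proof. by apply: tame_sum => j; apply: tameM; [exact: tame_cst|exact: tame_hat]. Qed.

Definition fe_grad p z : 'rV[R]_m.+1 :=
  \sum_k z k 0 *: simplex_grad a (elt p) (chi k).

Definition fe_drift p (v w : 'rV[R]_m.+1 -> 'rV[R]_m.+1) xi : 'rV[R]_m.+1 :=
  \sum_j hat p j xi *: (w (a j) - v (a j)).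

Lemma quad_entries (F : 'I_N -> 'I_N -> R) z y :
  quad (\matrix_(k, j) F k j) z y = \sum_k \sum_j z k 0 * y j 0 * F k j.
Proof.
rewrite /quad mxE exchange_big; apply: eq_bigr => j _.
rewrite mxE mulr_suml; apply: eq_bigr => k _.
by rewrite !mxE mulrAC.
Qed.

Lemma quad_surface (F : 'I_L -> 'I_N -> 'I_N -> T -> R) z y :
  (forall p k j, tame (F p k j)) ->
  quad (\matrix_(k, j) \sum_p vol p * simplex_int (F p k j)) z y =
  \sum_p vol p * simplex_int (fun xi => \sum_k \sum_j z k 0 * y j 0 * F p k j xi).
Proof.
move=> tF; rewrite quad_entries.
under eq_bigr do under eq_bigr do rewrite mulr_sumr.
under eq_bigr do rewrite exchange_big.
rewrite exchange_big; apply: eq_bigr => p _ /=.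
have tF' k j : tame (fun xi => z k 0 * y j 0 * F p k j xi).
  by apply: tameM; [exact: tame_cst | exact: tF].
rewrite simplex_int_sum => [|k]; last exact: tame_sum.
rewrite mulr_sumr; apply: eq_bigr => k _.
rewrite simplex_int_sum// mulr_sumr; apply: eq_bigr => j _.
by rewrite simplex_intZ// mulrCA.
Qed.

Lemma quad_mass z y : quad (mass_mx a elt chi) z y =
  \sum_p vol p * simplex_int (fun xi => fe_fun p z xi * fe_fun p y xi).
Proof.
pose F p k j xi := hat p k xi * hat p j xi.
have -> : mass_mx a elt chi = \matrix_(k, j) \sum_p vol p * simplex_int (F p k j).
  apply/matrixP => k j; rewrite !mxE; apply: eq_bigr => p _; congr (_ * _).
  by apply: eq_simplex_int => xi h; rewrite !chi_elt_map// mulrC.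
rewrite quad_surface => [|p k j]; last by apply: tameM; exact: tame_hat.
apply: eq_bigr => p _; congr (_ * _); apply: eq_simplex_int => xi _.
rewrite /fe_fun mulr_suml; apply: eq_bigr => k _; rewrite mulr_sumr.
by apply: eq_bigr => j _; rewrite /F mulrACA.
Qed.

Lemma quad_stiffness z y : quad (stiffness_mx a elt chi) z y =
  \sum_p vol p * (dotv (fe_grad p z) (fe_grad p y) * volD).
Proof.
pose F p k j xi := dotv (simplex_grad a (elt p) (chi k)) (simplex_grad a (elt p) (chi j)).
have -> : stiffness_mx a elt chi = \matrix_(k, j) \sum_p vol p * simplex_int (F p k j).
  apply/matrixP => k j; rewrite !mxE; apply: eq_bigr => p _; congr (_ * _).
  by apply: eq_simplex_int => xi h; rewrite dotvC.
rewrite quad_surface => [|p k j]; last exact: tame_cst.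
apply: eq_bigr => p _; congr (_ * _); rewrite -simplex_int_cst.
apply: eq_simplex_int => xi _.
rewrite /fe_grad dotv_suml; apply: eq_bigr => k _; rewrite dotv_sumr.
by apply: eq_bigr => j _; rewrite /F dotvZl dotvZr mulrA.
Qed.

Lemma tame_drift p v w (g : 'rV[R]_m.+1) : tame (fun xi => dotv (fe_drift p v w xi) g).
Proof.
have -> : (fun xi => dotv (fe_drift p v w xi) g) =
    fun xi => \sum_j dotv (w (a j) - v (a j)) g * hat p j xi.
  apply/funext => xi; rewrite /fe_drift dotv_suml; apply: eq_bigr => j _.
  by rewrite dotvZl mulrC.
by apply: tame_sum => j; apply: tameM; [exact: tame_cst|exact: tame_hat].
Qed.

Lemma quad_advection v w z y : quad (advection_mx a elt chi v w) z y =
  \sum_p vol p * simplex_int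
    (fun xi => fe_fun p y xi * dotv (fe_drift p v w xi) (fe_grad p z)).
Proof.
pose F p k j xi :=
  hat p j xi * dotv (fe_drift p v w xi) (simplex_grad a (elt p) (chi k)).
have -> : advection_mx a elt chi v w =
    \matrix_(k, j) \sum_p vol p * simplex_int (F p k j).
  apply/matrixP => k j; rewrite !mxE; apply: eq_bigr => p _; congr (_ * _).
  apply: eq_simplex_int => xi h; rewrite chi_elt_map// /F; congr (_ * dotv _ _).
  rewrite /interp -sumrN -big_split; apply: eq_bigr => i _ /=.
  by rewrite chi_elt_map// scalerBr.
rewrite quad_surface => [|p k j]; last first.
  by apply: tameM; [exact: tame_hat | exact: tame_drift].
apply: eq_bigr => p _; congr (_ * _); apply: eq_simplex_int => xi _.
rewrite /fe_grad dotv_sumr mulr_sumr; apply: eq_bigr => k _.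
rewrite /fe_fun mulr_suml; apply: eq_bigr => j _.
by rewrite /F dotvZr; ring.
Qed.

Lemma mass_psd : psd (mass_mx a elt chi).
Proof.
split.
  apply/matrixP => k j; rewrite !mxE; apply: eq_bigr => p _; congr (_ * _).
  by apply: eq_simplex_int => xi _; rewrite mulrC.
move=> z; rewrite quad_mass; apply: sumr_ge0 => p _.
rewrite mulr_ge0 ?(ltW (vol_gt0 p))// simplex_int_ge0// => xi _.
by rewrite -expr2 sqr_ge0.
Qed.

Lemma stiffness_psd : psd (stiffness_mx a elt chi).
Proof.
split.
  apply/matrixP => k j; rewrite !mxE; apply: eq_bigr => p _; congr (_ * _).
  by apply: eq_simplex_int => xi _; rewrite dotvC.
move=> z; rewrite quad_stiffness; apply: sumr_ge0 => p _.
rewrite !mulr_ge0 ?(ltW (vol_gt0 p)) ?dotvv_ge0//.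
exact: ltW (lebesgue_unit_simplex_gt0 R m).
Qed.

Lemma advection_le v w (om : R) z y (s : R) :
  (forall j, normv (w (a j) - v (a j)) <= om) -> 0 < s ->
  quad (advection_mx a elt chi v w) z y <=
  s / 2 * om ^+ 2 * quad (mass_mx a elt chi) y y +
  (2 * s)^-1 * quad (stiffness_mx a elt chi) z z.
Proof.
move=> wv s0; rewrite quad_advection quad_mass quad_stiffness !mulr_sumr -big_split.
apply: ler_sum => p _ /=; set G := fe_grad p z; set f := fe_fun p y.
have tf : tame (fun xi => f xi * f xi) by apply: tameM; exact: tame_fe_fun.
rewrite !(mulrCA _ (vol p)) -mulrDr ler_wpM2l ?(ltW (vol_gt0 p))//.
have tf' : tame (fun xi => s / 2 * om ^+ 2 * (f xi * f xi)).
  by apply: tameM => //; exact: tame_cst.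
have -> : s / 2 * om ^+ 2 * simplex_int (fun xi => f xi * f xi) +
    (2 * s)^-1 * (dotv G G * volD) =
    simplex_int (fun xi => s / 2 * om ^+ 2 * (f xi * f xi) + (2 * s)^-1 * dotv G G).
  rewrite simplex_intD; [|exact: tf'|exact: tame_cst].
  rewrite (simplex_intZ _ tf) simplex_int_cst.
  by congr (_ + _); rewrite mulrA.
apply: simplex_int_le.
- by apply: tameM; [exact: tame_fe_fun | exact: tame_drift].
- by apply: tameD => //; exact: tame_cst.
move=> xi h; apply: le_trans (dotv_young _ _ _ s0) _.
rewrite lerD2r -[leRHS]mulrA ler_wpM2l ?divr_ge0 ?(ltW s0)//.
rewrite -expr2 mulrC ler_wpM2r ?sqr_ge0//.
apply: dotv_convex => [j||j]; [exact: hat_ge0 | exact: sum_hat|].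
have := wv j; rewrite /normv; set q := dotv _ _ => hq.
have q0 : 0 <= q by exact: dotvv_ge0.
rewrite -(sqr_sqrtr q0) lerXn2r ?nnegrE ?sqrtr_ge0//.
by apply: le_trans hq; exact: sqrtr_ge0.
Qed.

Lemma fe_gradE p z : fe_grad p z =
  (\row_(i < m) (z (elt p (lift ord0 i)) 0 - z (elt p ord0) 0))
    *m invmx (gram a (elt p)) *m edges a (elt p).
Proof.
rewrite /fe_grad /simplex_grad.
under eq_bigr do rewrite !scalemxAl.
rewrite -!mulmx_suml; congr (_ *m _ *m _); apply/rowP => i.
rewrite summxE mxE.
have kr j i' : chi j (a i') = (i' == j)%:R by have [_ _] := nb j; apply.
have sz i' : z i' 0 = \sum_k z k 0 * (i' == k)%:R.
  rewrite (bigD1 i')//= eqxx mulr1 big1 ?addr0// => k; rewrite eq_sym => /negPf ->.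
  by rewrite mulr0.
rewrite (sz (elt p (lift ord0 i))) (sz (elt p ord0)) -sumrN -big_split.
by apply: eq_bigr => k _ /=; rewrite !mxE !kr mulrBr.
Qed.

Lemma fe_grad_eq0 p z i : fe_grad p z = 0 -> z (elt p i) 0 = z (elt p ord0) 0.
Proof.
have [_ /(_ p)[_ fr] _ _ _] := tri.
rewrite fe_gradE => h.
case: (unliftP ord0 i) => [j|] -> //; apply/eqP; rewrite -subr_eq0.
have {}h : \row_(i < m) (z (elt p (lift ord0 i)) 0 - z (elt p ord0) 0) = 0.
  apply: (@row_free_inj _ _ _ _ (invmx (gram a (elt p)))).
    by rewrite row_free_unit unitmx_inv; exact: gram_unitmx.
  by apply: (row_free_inj fr); rewrite h !mul0mx.
by move/rowP: h => /(_ j); rewrite !mxE => ->.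
Qed.

Lemma stiffness_mass_unitmx :
  stiffness_mx a elt chi + mass_mx a elt chi \in unitmx.
Proof.
have [[_ pA] [_ pM]] := (stiffness_psd, mass_psd).
have volD0 : 0 < volD := lebesgue_unit_simplex_gt0 R m.
apply: quad_eq0_unitmx => z; rewrite quad_mxD => /eqP.
rewrite paddr_eq0// => /andP[/eqP Az /eqP Mz].
have gz p : fe_grad p z = 0.
  apply: dotvv_eq0; move/eqP: Az; rewrite quad_stiffness psumr_eq0 => [|q _].
    move/allP/(_ p); rewrite mem_index_enum => /(_ isT).
    by rewrite !mulf_eq0 (gt_eqF (vol_gt0 p)) (gt_eqF volD0) orbF => /eqP.
  by rewrite !mulr_ge0 ?(ltW (vol_gt0 q)) ?dotvv_ge0// ltW.
have fz p xi : fe_fun p z xi = z (elt p ord0) 0.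
  rewrite -[RHS]mulr1 -(sum_bary xi) mulr_sumr /fe_fun.
  rewrite [RHS](partition_big (elt p) xpredT)//=; apply: eq_bigr => j _.
  rewrite /hat mulr_sumr; apply: eq_bigr => i /eqP <-.
  by rewrite (fe_grad_eq0 i (gz p)).
have z0 p : z (elt p ord0) 0 = 0.
  move/eqP: Mz; rewrite quad_mass psumr_eq0 => [|q _]; last first.
    rewrite mulr_ge0 ?(ltW (vol_gt0 q))// simplex_int_ge0// => xi _.
    by rewrite -expr2 sqr_ge0.
  move/allP/(_ p); rewrite mem_index_enum => /(_ isT).
  rewrite (eq_simplex_int (g := fun=> z (elt p ord0) 0 ^+ 2)) => [|xi _]; last first.
    by rewrite fz expr2.
  rewrite simplex_int_cst !mulf_eq0 (gt_eqF (vol_gt0 p)) (gt_eqF volD0) orbF.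
  by rewrite orbb => /eqP.
apply/colP => j; rewrite mxE; have [/(_ j)[p /codomP[i ->]] _ _ _ _] := tri.
by rewrite (fe_grad_eq0 i (gz p)).
Qed.

End FiniteElements.

Lemma bdf_residualB (R : realType) (k N : nat) (tau : R) (M A B : R -> 'M[R]_N)
    (x y : nat -> 'cV[R]_N) (n : nat) :
  bdf_residual k tau M A B (fun i => x i - y i) n =
  bdf_residual k tau M A B x n - bdf_residual k tau M A B y n.
Proof.
rewrite /bdf_residual !mulmxBr; under eq_bigr do rewrite mulmxBr scalerBr.
by rewrite sumrB scalerBr !opprD [RHS]addrACA [X in _ = X + _]addrACA.
Qed.

Theorem lemma5p3 (R : realType) (k : nat) (hk : (1 <= k <= 5)%N)
    (mu kappa omega : R) :
  exists tau0 : R, 0 < tau0 /\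
  forall T : R, 0 < T ->
  exists C : R,
  forall (m : nat) (Gam : R -> set 'rV[R]_m.+1)
    (Phi v Ale w : R -> 'rV[R]_m.+1 -> 'rV[R]_m.+1),
  (1 <= m)%N ->
  (forall t, 0 <= t <= T -> closed_hypersurface (Gam t)) ->
  flow_map T Gam Phi v ->
  flow_map T Gam Ale w ->
  (forall t x, 0 <= t <= T -> Gam t x -> normv (w t x - v t x) <= omega) ->
  forall (N L : nat) (a0 : 'I_N -> 'rV[R]_m.+1) (elt : 'I_L -> 'I_m.+1 -> 'I_N)
    (h c : R) (chi : R -> 'I_N -> 'rV[R]_m.+1 -> R),
  let a := fun (t : R) (j : 'I_N) => Ale t (a0 j) in
  (forall j, Gam 0 (a0 j)) ->
  0 < c -> admissible T h c a elt ->
  (forall t, 0 <= t <= T -> nodal_basis (a t) elt (chi t)) ->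
  let M := fun t => mass_mx (a t) elt (chi t) in
  let A := fun t => stiffness_mx (a t) elt (chi t) in
  let B := fun t => advection_mx (a t) elt (chi t) (v t) (w t) in
  growth_bound T M mu ->
  growth_bound T (fun t => invmx (M t)) mu ->
  growth_bound T A kappa ->
  forall (tau : R) (alpha : nat -> 'cV[R]_N)
    (r alphat : R -> 'cV[R]_N) (alphat0 : 'cV[R]_N),
  0 < tau <= tau0 ->
  (forall n, (k <= n)%N -> n%:R * tau <= T ->
     bdf_residual k tau M A B alpha n = 0) ->
  alphat 0 = alphat0 ->
  (forall t, 0 <= t <= T ->
     exists2 l, deriv_in T (fun s => M s *m alphat s) t l &
       l + A t *m alphat t + B t *m alphat t = M t *m r t) ->
  let tn := fun n : nat => n%:R * tau in
  let d := fun n => - bdf_residual k tau M A B (fun i => alphat (tn i)) n in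
  let e := fun n => alpha n - alphat (tn n) in
  forall n : nat, (k <= n)%N -> tn n <= T ->
    mxnorm (M (tn n)) (e n) ^+ 2
      + tau * (\sum_(k <= j < n.+1) mxnorm (A (tn j)) (e j) ^+ 2)
    <= C * tau * (\sum_(k <= j < n.+1) dual_norm2 (M (tn j)) (A (tn j)) (d j))
      + C * \big[Num.max/0]_(i < k) (mxnorm (M (tn i)) (e i) ^+ 2).
Proof.
have [tau0 [tau0_gt0 stab]] := bdf_stability hk mu kappa omega.
exists tau0; split=> // T _; have [C HC] := stab T; exists C.
move=> m Gam Phi v Ale w _ _ _ [_ _ Ale_diffeo _] wv N L a0 elt h c chi a a0G _
  [tri _ _] nb M A B gM _ gA tau alpha r alphat alphat0 htau res _ _ tn d e n kn nT.
apply: (HC N M A B _ _ _ _ gM gA tau e d htau n kn nT) => [t tT|t tT|t tT|t tT y z s s0|j].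
- exact: mass_psd (tri t tT) (nb t tT).
- exact: stiffness_psd (tri t tT).
- exact: stiffness_mass_unitmx (tri t tT) (nb t tT).
- apply: (advection_le (tri t tT) (nb t tT)) s0 => j.
  apply: wv => //; have [_ AleG _] := Ale_diffeo t tT; exact/AleG/a0G.
move=> /andP[kj jn]; rewrite bdf_residualB res ?sub0r//.
apply: le_trans nT; rewrite ler_wpM2r ?ler_nat//.
by have /andP[/ltW] := htau.
Qed.
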